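(* Let $T>0$, $h\in(0,T/2]$, $c\in(0,T)$ and $\mu_1,\mu_2,\sigma_1^2,\sigma_2^2>0$. Let $\Phi_1(\mu_1,\sigma_1^2)$ and $\Phi_2(\mu_2,\sigma_2^2)$ be independent renewal processes and let $\Phi^{(n)}=\Phi_1|_{(0,nc]}\cup\Phi_2|_{(nc,nT]}$, $n\ge1$. Let $s^{(n)}$, $\hat s^{(n)}$ and $\tilde s^{(n)}$, indexed by $t\in\tau_h=[h,T-h]$, be as defined in the context. Then, almost surely as $n\to\infty$, $$\left(\frac{s_t^{(n)}}{\hat s_t^{(n)}}\right)_{t\in\tau_h}\longrightarrow\left(\frac{s_t^{(1)}}{\tilde s_t^{(1)}}\right)_{t\in\tau_h}=:(\Delta_t)_{t\in\tau_h}$$ in $D[h,T-h]$ with respect to the supremum norm.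
   Context: **Renewal processes.** A renewal process (RP) $\Phi(\mu,\sigma^2)$ is a point process on the positive line with events $0<S_1<S_2<\cdots$ whose life times $\xi_1=S_1$, $\xi_j=S_j-S_{j-1}$ ($j\ge2$) are positive, i.i.d. and square-integrable with mean $\mu$ and variance $\sigma^2>0$. $\Phi|_{(a,b]}$ is the restriction of $\Phi$ to events in $(a,b]$. **Compound process.** $\Phi^{(n)}$ has events (in increasing order) $S_1^{(n)}<S_2^{(n)}<\cdots$, life times $\xi_1^{(n)}=S_1^{(n)}$, $\xi_j^{(n)}=S_j^{(n)}-S_{j-1}^{(n)}$, and counting process $N_t^{(n)}=\max\{j\ge1:S_j^{(n)}\le t\}$ with $\max\emptyset=0$. $D[h,T-h]$ is the set of càdlàg functions on $[h,T-h]$. **True scaling.** $s_t^{(n)}\ge0$ with $$(s_t^{(n)})^2=\begin{cases}2nh\sigma_1^2/\mu_1^3,& t<c-h,\\ n\big((t+h-c)\sigma_2^2/\mu_2^3+(c-(t-h))\sigma_1^2/\mu_1^3\big),&|t-c|\le h,\\ 2nh\sigma_2^2/\mu_2^3,&t>c+h.\end{cases}$$ **Estimators.** For the right window $(nt,n(t+h)]$ let $$\hat\mu_{ri}(nh,nt)=\frac{1}{N_{n(t+h)}^{(n)}-N_{nt}^{(n)}-1}\sum_{i=N_{nt}^{(n)}+2}^{N_{n(t+h)}^{(n)}}\xi_i^{(n)}\quad\text{if } N_{n(t+h)}^{(n)}-N_{nt}^{(n)}>1,$$ $$\hat\sigma^2_{ri}(nh,nt)=\frac{1}{N_{n(t+h)}^{(n)}-N_{nt}^{(n)}-2}\sum_{i=N_{nt}^{(n)}+2}^{N_{n(t+h)}^{(n)}}\big(\xi_i^{(n)}-\hat\mu_{ri}(nh,nt)\big)^2\quad\text{if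 } N_{n(t+h)}^{(n)}-N_{nt}^{(n)}>2,$$ and $0$ otherwise. $\hat\mu_{le}(nh,nt),\hat\sigma^2_{le}(nh,nt)$ are defined in the same way for the left window $(n(t-h),nt]$, i.e. with $N^{(n)}_{nt}$ replaced by $N^{(n)}_{n(t-h)}$ and $N^{(n)}_{n(t+h)}$ replaced by $N^{(n)}_{nt}$. Let $\hat s_t^{(n)}\ge0$ with $$(\hat s_t^{(n)})^2=\Big(\frac{\hat\sigma_{ri}^2(nh,nt)}{\hat\mu_{ri}^3(nh,nt)}+\frac{\hat\sigma_{le}^2(nh,nt)}{\hat\mu_{le}^3(nh,nt)}\Big)nh,$$ quotients with zero denominator (also in $s_t^{(n)}/\hat s_t^{(n)}$) being read as $0$. **Limits of the estimators.** For $a,b\ge0$ with $a+b=h$ put $$M(a,b)=\frac{h\mu_1\mu_2}{a\mu_2+b\mu_1},\qquad V(a,b)=\frac{\mu_1\mu_2\,ab\,[(\sigma_1-\sigma_2)^2+(\mu_1-\mu_2)^2]+[b\mu_1\sigma_2+a\mu_2\sigma_1]^2}{[a\mu_2+b\mu_1]^2}.$$ Set $(\mu_{ri},\sigma^2_{ri})(h,t)=(\mu_1,\sigma_1^2)$ for $t\le c-h$, $=(M,V)(c-t,\,t+h-c)$ for $t\in(c-h,c]$, $=(\mu_2,\sigma_2^2)$ for $t>c$; and $(\mu_{le},\sigma^2_{le})(h,t)=(\mu_1,\sigma_1^2)$ for $t\le c$, $=(M,V)(c-t+h,\,t-c)$ for $t\in(c,c+h]$, $=(\mu_2,\sigma_2^2)$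 for $t>c+h$. Let $\tilde s_t^{(n)}\ge0$ with $$(\tilde s_t^{(n)})^2=\Big(\frac{\sigma_{ri}^2(h,t)}{\mu_{ri}^3(h,t)}+\frac{\sigma_{le}^2(h,t)}{\mu_{le}^3(h,t)}\Big)nh.$$ *)

(* Defs.v *)
From mathcomp Require Import all_boot all_order all_algebra.
From mathcomp Require Import all_classical all_reals all_analysis.

Set Implicit Arguments.
Unset Strict Implicit.
Unset Printing Implicit Defensive.

Import Order.TTheory GRing.Theory Num.Theory.
Import numFieldNormedType.Exports.

Local Open Scope classical_set_scope.
Local Open Scope ring_scope.

Definition mutually_independent (R : realType) (d : measure_display)
    (Omega : measurableType d) (P : probability Omega R)
    (X : nat -> {RV P >-> R}) : Prop :=
  forall (J : seq nat) (B : nat -> set R),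
    uniq J -> (forall j, measurable (B j)) ->
    (P (\bigcap_(j in [set` J]) (X j @^-1` B j)) =
     \prod_(j <- J) P (X j @^-1` B j))%E.

Definition identically_distributed (R : realType) (d : measure_display)
    (Omega : measurableType d) (P : probability Omega R)
    (X : nat -> {RV P >-> R}) : Prop :=
  forall (i j : nat) (B : set R), measurable B ->
    distribution P (X i) B = distribution P (X j) B.

Definition sigma_generated (R : realType) (d : measure_display)
    (Omega : measurableType d) (P : probability Omega R)
    (X : nat -> {RV P >-> R}) : set (set Omega) :=
  <<s [set A | exists (j : nat) (B : set R),
                 measurable B /\ A = X j @^-1` B] >>.

Definition independent_processes (R : realType) (d : measure_display)
    (Omega : measurableType d) (P : probability Omega R)
    (X Y : nat -> {RV P >-> R}) : Prop :=
  forall A B : set Omega, sigma_generated X A -> sigma_generated Y B ->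
    (P (A `&` B) = P A * P B)%E.

(* Sequences of life times are indexed from 0: [xi j] is the (j+1)-st one. *)
Record renewal_process (R : realType) (d : measure_display)
    (Omega : measurableType d) (P : probability Omega R)
    (xi : nat -> {RV P >-> R}) (mu sigma2 : R) : Prop := RenewalProcess {
  renewal_gt0 : forall j w, 0 < xi j w ;
  renewal_indep : mutually_independent xi ;
  renewal_ident : identically_distributed xi ;
  renewal_sqint : forall j, (xi j : Omega -> R) \in Lfun P 2%:E ;
  renewal_mean : forall j, ('E_P[xi j] = mu%:E)%E ;
  renewal_var : forall j, ('V_P[xi j] = sigma2%:E)%E }.

Definition renewal_events (R : realType) (x : nat -> R) : set R :=
  [set \sum_(i < j) x i | j in [set j : nat | (0 < j)%N]].

(* The path of the compound process, as a set of points, when the life times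
   of the two renewal processes are [x1] and [x2]. *)
Definition compound_events (R : realType) (T c : R) (x1 x2 : nat -> R)
    (n : nat) : set R :=
  (renewal_events x1 `&` `]0, n%:R * c]) `|`
  (renewal_events x2 `&` `]n%:R * c, n%:R * T]).

(* [event_time A j] is the j-th smallest point of [A], a locally finite set of
   positive reals, and is +oo when [A] has fewer than j points;
   [event_time A 0] is the origin, so that [life_time A 1] is the first event. *)
Fixpoint event_time (R : realType) (A : set R) (j : nat) : \bar R :=
  if j is k.+1 then
    ereal_inf [set x%:E | x in [set x | A x /\ (event_time A k < x%:E)%E]]
  else 0%E.

Definition life_time (R : realType) (A : set R) (j : nat) : R :=
  fine (event_time A j) - fine (event_time A j.-1).

(* max {j >= 1 | S_j <= t}, with max of the empty set equal to 0. *)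
Definition counting (R : realType) (A : set R) (t : R) : nat :=
  let J := [set j : nat | (0 < j)%N /\ (event_time A j <= t%:E)%E] in
  xget 0%N [set j | J j /\ forall k, J k -> (k <= j)%N].

Definition window_count (R : realType) (A : set R) (a b : R) : nat :=
  (counting A b - counting A a)%N.

(* Estimators from the life times lying in the window (a, b]. *)
Definition mu_hat (R : realType) (A : set R) (a b : R) : R :=
  if (1 < window_count A a b)%N then
    ((window_count A a b - 1)%N%:R)^-1 *
    \sum_((counting A a).+2 <= i < (counting A b).+1) life_time A i
  else 0.

Definition sigma2_hat (R : realType) (A : set R) (a b : R) : R :=
  if (2 < window_count A a b)%N then
    ((window_count A a b - 2)%N%:R)^-1 *
    \sum_((counting A a).+2 <= i < (counting A b).+1)
       (life_time A i - mu_hat A a b) ^+ 2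
  else 0.

(* Division by zero yields zero, since 0^-1 = 0. *)
Definition s_hat (R : realType) (h : R) (A : set R) (n : nat) (t : R) : R :=
  Num.sqrt
    ((sigma2_hat A (n%:R * t) (n%:R * (t + h)) /
        mu_hat A (n%:R * t) (n%:R * (t + h)) ^+ 3 +
      sigma2_hat A (n%:R * (t - h)) (n%:R * t) /
        mu_hat A (n%:R * (t - h)) (n%:R * t) ^+ 3) * (n%:R * h)).

Definition s_true (R : realType) (h c mu1 mu2 sigma1 sigma2 : R)
    (n : nat) (t : R) : R :=
  Num.sqrt
    (if t < c - h then 2 * n%:R * h * sigma1 ^+ 2 / mu1 ^+ 3
     else if `|t - c| <= h then
       n%:R * ((t + h - c) * sigma2 ^+ 2 / mu2 ^+ 3 +
               (c - (t - h)) * sigma1 ^+ 2 / mu1 ^+ 3)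
     else 2 * n%:R * h * sigma2 ^+ 2 / mu2 ^+ 3).

Definition mix_mean (R : realType) (h mu1 mu2 a b : R) : R :=
  h * mu1 * mu2 / (a * mu2 + b * mu1).

Definition mix_var (R : realType) (mu1 mu2 sigma1 sigma2 a b : R) : R :=
  (mu1 * mu2 * (a * b) * ((sigma1 - sigma2) ^+ 2 + (mu1 - mu2) ^+ 2) +
   (b * mu1 * sigma2 + a * mu2 * sigma1) ^+ 2) /
  (a * mu2 + b * mu1) ^+ 2.

Definition mu_ri (R : realType) (h c mu1 mu2 t : R) : R :=
  if t <= c - h then mu1
  else if t <= c then mix_mean h mu1 mu2 (c - t) (t + h - c)
  else mu2.

Definition sigma2_ri (R : realType) (h c mu1 mu2 sigma1 sigma2 t : R) : R :=
  if t <= c - h then sigma1 ^+ 2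
  else if t <= c then mix_var mu1 mu2 sigma1 sigma2 (c - t) (t + h - c)
  else sigma2 ^+ 2.

Definition mu_le (R : realType) (h c mu1 mu2 t : R) : R :=
  if t <= c then mu1
  else if t <= c + h then mix_mean h mu1 mu2 (c - t + h) (t - c)
  else mu2.

Definition sigma2_le (R : realType) (h c mu1 mu2 sigma1 sigma2 t : R) : R :=
  if t <= c then sigma1 ^+ 2
  else if t <= c + h then mix_var mu1 mu2 sigma1 sigma2 (c - t + h) (t - c)
  else sigma2 ^+ 2.

Definition s_tilde (R : realType) (h c mu1 mu2 sigma1 sigma2 : R)
    (n : nat) (t : R) : R :=
  Num.sqrt
    ((sigma2_ri h c mu1 mu2 sigma1 sigma2 t / mu_ri h c mu1 mu2 t ^+ 3 +
      sigma2_le h c mu1 mu2 sigma1 sigma2 t / mu_le h c mu1 mu2 t ^+ 3) *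
     (n%:R * h)).

(* Only the values of [f] on [a, b] matter. *)
Definition cadlag (R : realType) (a b : R) (f : R -> R) : Prop :=
  (forall t, t \in `[a, b[ -> f x @[x --> t^'+] --> f t) /\
  (forall t, t \in `]a, b] -> cvg (f x @[x --> t^'-])).

(* The supremum is taken in the extended reals because the real-valued [sup]
   of an unbounded set is 0. *)
Definition cvg_supnorm (R : realType) (a b : R) (f : nat -> R -> R)
    (g : R -> R) : Prop :=
  ereal_sup [set (`|f n t - g t|)%:E | t in `[a, b]] @[n --> \oo] --> 0%E.

(* Main.v *)
(* Almost surely, the averages of the life times and of their squares converge for both
   processes; the squares being merely integrable, this needs the strong law under a first
   moment condition. Everything else happens on one such path. The compound path follows
   the first event sequence up to time nc and the second one afterwards, so the number of
   events, the last event time and the sum of squared life times up to time nu, divided by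
   n, converge for each u to a piecewise linear limit. These quantities are monotone in u
   and the limits are continuous, hence they converge jointly as n tends to infinity and u
   tends to t. On a window the estimators are rational functions of them, so the ratio
   converges jointly as well, and compactness of [h, T - h] turns joint convergence into
   uniform convergence. *)

Require Import Defs.
From mathcomp Require Import all_boot all_order all_algebra.
From mathcomp Require Import all_classical all_reals all_analysis.
From mathcomp Require Import measurable_realfun.
From mathcomp Require Import ring lra zify.
Import Order.TTheory GRing.Theory Num.Theory.
Import numFieldNormedType.Exports.
Set Implicit Arguments.
Unset Strict Implicit.
Unset Printing Implicit Defensive.
Local Open Scope classical_set_scope.
Local Open Scope ring_scope.

(** * The strong law of large numbers for nonnegative variables *)

(** The estimators start at the second event of a window, and the compound path has one life time
    across [nc] that belongs to neither process. One fact makes both harmless: a squared life time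
    is an increment of the sum of squares, and since that sum divided by n has the same limit at an
    index and at its successor, a single squared life time is o(n). The life time across [nc] is at
    most the sum of the two original life times that cover [nc]. The limits are needed at all real
    times, because the left window for t = h starts at 0 and the monotonicity argument looks
    slightly to its left; hence [Num.max 0 u] in the limits. The estimators have default values on
    windows with few events. The limiting event count is strictly increasing on nonnegative times,
    so a window holds more than 2 events for all large n and all times near t; the limiting means
    and variances are positive, so no limiting denominator vanishes. In the strong law the expected
    costs of the truncated rows are summable over the blocks, so the cost itself is almost surely
    summable and tends to 0. *)

(* Geometric growth with ratio 1 + 1/(p+1), kept within nat. *)
Fixpoint block (p n : nat) : nat :=
  if n is k.+1 then (block p k + (block p k %/ p.+1).+1)%N else 1%N.

Lemma block_gt0 p n : (0 < block p n)%N.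
Proof. by case: n => [//|n] /=; rewrite addnS. Qed.

Lemma block_ltS p n : (block p n < block p n.+1)%N.
Proof. by rewrite /= addnS ltnS leq_addr. Qed.

Lemma ltn_block p n : (n < block p n)%N.
Proof. elim: n => [//|n IH]; exact: leq_ltn_trans IH (block_ltS p n). Qed.

Section block_real.
Variables (R : realType) (p : nat).
Local Notation k n := ((block p n)%:R : R).

Lemma blockr_gt0 n : 0 < k n.
Proof. by rewrite ltr0n block_gt0. Qed.

(** Rounding the quotient down and adding one overshoots the exact increment [k n / (p+1)], by at
    most 1. The lower bound makes sums over blocks geometric; the upper bound [blockS_le] keeps
    neighbouring blocks comparable. *)
Lemma blockS_ge n : k n * p.+2%:R <= k n.+1 * p.+1%:R.
Proof.
rewrite -!natrM ler_nat /=; have := divn_eq (block p n) p.+1.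
have := ltn_pmod (block p n) (ltn0Sn p); nia.
Qed.

Lemma blockS_le n : k n.+1 * p.+1%:R <= k n * p.+2%:R + p.+1%:R.
Proof.
rewrite -!natrM -natrD ler_nat /=; have := divn_eq (block p n) p.+1; nia.
Qed.

(** A geometric sum is dominated by its last term: [blockS_ge] amounts to
    [k n <= (p+1) (k n.+1 - k n)], which telescopes, and the last block counted is below x. *)
Lemma sum_block_below (x : R) N : 0 <= x ->
  \sum_(n < N | k n < x) k n <= p.+2%:R * x.
Proof.
move=> x0.
have sumall M : \sum_(n < M) k n <= p.+1%:R * k M.
  elim: M => [|M IH]; first by rewrite big_ord0 mulr_ge0// ltW// blockr_gt0.
  rewrite big_ord_recr; have := blockS_ge M.
  by rewrite -(natr1 p.+1); move: IH; rewrite [k M.+1]lock /=; lra.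
elim: N => [|N IH]; first by rewrite big_ord0 mulr_ge0.
rewrite big_mkcond big_ord_recr /= -big_mkcond /=.
case: ifPn => [kx|_]; last by rewrite addr0.
apply: (@le_trans _ _ (p.+1%:R * k N + k N)).
  rewrite lerD2r; apply: le_trans (sumall N).
  by rewrite [leRHS](bigID (fun n : 'I_N => k n < x)) /= lerDl sumr_ge0// => i _;
    rewrite ltW// blockr_gt0.
by rewrite -[X in _ + X]mul1r -mulrDl natr1 ler_pM2l// ltW.
Qed.

Lemma sum_block_above (x : R) N : 0 <= x ->
  \sum_(n < N | x <= k n) x ^+ 2 / k n <= p.+2%:R * x.
Proof.
rewrite le_eqVlt => /predU1P[<-|x0].
  by rewrite mulr0 big1// => i _; rewrite expr0n mul0r.
have step n : (k n)^-1 <= p.+2%:R * ((k n)^-1 - (k n.+1)^-1).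
  have kn := blockr_gt0 n; have kn1 := blockr_gt0 n.+1.
  have -> : p.+2%:R * ((k n)^-1 - (k n.+1)^-1) =
     (k n)^-1 + ((p.+1%:R * k n.+1 - p.+2%:R * k n) / (k n * k n.+1)).
    rewrite -(natr1 p.+1); field; by rewrite !gt_eqF.
  rewrite lerDl divr_ge0//.
  by rewrite subr_ge0 ![p.+1%:R * _]mulrC ![p.+2%:R * _]mulrC blockS_ge.
(* [Num.max 0] covers the stage of the induction at which no block has reached x: the sum is empty
   there and the telescoped bound is negative. *)
suff : \sum_(n < N | x <= k n) (k n)^-1 <= p.+2%:R * Num.max 0 (x^-1 - (k N)^-1).
  move=> h; rewrite -mulr_sumr.
  apply: (@le_trans _ _ (x ^+ 2 * (p.+2%:R * x^-1))).
    rewrite ler_pM2l ?exprn_gt0//; apply: le_trans h _.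
    rewrite ler_pM2l// ge_max invr_ge0 (ltW x0)/= gerDl oppr_le0 invr_ge0 ltW//.
    exact: blockr_gt0.
  by rewrite mulrCA ler_pM2l// expr2 mulfK ?gt_eqF.
elim: N => [|N IH]; first by rewrite big_ord0 mulr_ge0// le_max lexx.
rewrite big_mkcond big_ord_recr /= -big_mkcond /=.
have kNS : (k N.+1)^-1 <= (k N)^-1.
  by rewrite lef_pV2 ?posrE ?blockr_gt0// ler_nat ltnW// block_ltS.
case: ifPn => [xk|_]; last first.
  rewrite addr0; apply: le_trans IH _; rewrite ler_pM2l// le_max2//.
  by rewrite lerD2l lerN2.
have xk' : (k N)^-1 <= x^-1 by rewrite lef_pV2 ?posrE ?blockr_gt0.
rewrite (max_r _) ?subr_ge0// in IH.
rewrite (max_r _) ?subr_ge0//; last exact: le_trans kNS xk'.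
apply: (le_trans (lerD IH (step N))).
by rewrite -mulrDr addrA subrK.
Qed.

End block_real.

Lemma exists_block p N : (0 < N)%N -> exists n, (block p n <= N < block p n.+1)%N.
Proof.
move=> N0; elim: N N0 => [//|N IH] _; case: N IH => [|N] IH.
  by exists 0%N.
have [n /andP[nN Nn]] := IH isT.
have [h|h] := ltnP N.+2 (block p n.+1); first by exists n; rewrite h (leq_trans nN).
by exists n.+1; rewrite h (leq_trans _ (block_ltS p n.+1)).
Qed.

(** As P <= K, the growth condition gives K'/K <= (P+2)/P. Exchanging the denominator M for K or K'
    thus costs a factor of at most 1 + 2/P on a ratio near m; the bound on 2(m+1)/P pays for this,
    the bound on d for the errors at the two blocks. *)
Lemma ratio_sandwich (R : realFieldType) (m e d P K K' M s s' sM : R) :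
  0 <= m -> 0 < d -> d <= 1 -> d <= e / 2 -> 0 < P -> 2 * (m + 1) / P <= e / 2 ->
  P <= K -> K <= M -> M <= K' -> K' * P <= K * (P + 1) + P ->
  0 <= s -> s <= sM -> sM <= s' ->
  `|m - s' / K'| <= d -> `|m - s / K| <= d -> `|m - sM / M| <= e.
Proof.
move=> m0 d0 d1 de P0 pe PK KM MK' KK' s0 S2 S1.
have K0 : 0 < K by lra.
have M0 : 0 < M by lra.
have K'0 : 0 < K' by lra.
rewrite !ler_distlC; move=> /andP[_ h'] /andP[h _].
rewrite ler_pdivlMr// in h; rewrite ler_pdivrMr// in h'.
rewrite ler_pdivrMr// in pe.
rewrite ler_pdivlMr// ler_pdivrMr//.
have KP : K' * P <= M * (P + 2) by nra.
have PM0 : 0 < P * M by rewrite mulr_gt0.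
have pe' : M * (2 * (m + 1)) <= M * (e / 2 * P) by rewrite ler_pM2l.
apply/andP; split.
  have [md|md] := lerP m d.
    apply: (@le_trans _ _ 0); last exact: le_trans s0 S2.
    by rewrite pmulr_lle0//; lra.
  have h1 : (m - d) * (P * M) <= (m - d) * (K * (P + 2)).
    by rewrite ler_pM2l ?subr_gt0//; nra.
  have h2 : (m - d) * K * (P + 2) <= sM * (P + 2).
    by rewrite ler_pM2r; lra.
  have h3 : d * (P * M) <= e / 2 * (P * M) by rewrite ler_pM2r.
  have h4 : 0 <= M * e by rewrite mulr_ge0; lra.
  suff : (m - e) * M * (P + 2) <= sM * (P + 2) by rewrite ler_pM2r//; lra.
  nra.
have h1 : (m + d) * (K' * P) <= (m + d) * (M * (P + 2)) by rewrite ler_pM2l//; lra.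
have h2 : sM * P <= (m + d) * K' * P by rewrite ler_pM2r//; lra.
have h3 : d * (P * M) <= e / 2 * (P * M) by rewrite ler_pM2r.
have h4 : d * M <= 1 * M by rewrite ler_pM2r.
suff : sM * P <= (m + e) * M * P by rewrite ler_pM2r//.
nra.
Qed.

Lemma cvg_mean_of_blocks (R : realType) (S : nat -> R) (m : R) :
  nondecreasing_seq S -> (forall n, 0 <= S n) -> 0 <= m ->
  (forall p, S (block p n) / (block p n)%:R @[n --> \oo] --> m) ->
  S n / n%:R @[n --> \oo] --> m.
Proof.
move=> ndS S0 m0 Sm; apply/cvgrPdist_le => e e0.
have [p pe] : exists p : nat, 2 * (m + 1) / p.+1%:R <= e / 2.
  exists (Num.bound (4 * (m + 1) / e)).
  rewrite ler_pdivrMr// -ler_pdivrMl ?divr_gt0//.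
  apply: (@le_trans _ _ (4 * (m + 1) / e)).
    by rewrite le_eqVlt; apply/orP; left; apply/eqP; field; rewrite gt_eqF.
  apply: le_trans (ltW (archi_boundP _)) _; last by rewrite ler_nat.
  by rewrite divr_ge0 ?(ltW e0)// mulr_ge0// addr_ge0.
pose d := Num.min 1 (e / 2).
have d0 : 0 < d by rewrite lt_min ltr01 divr_gt0.
have d1 : d <= 1 by rewrite ge_min lexx.
have de : d <= e / 2 by rewrite ge_min lexx orbT.
move/cvgrPdist_le : (Sm p) => /(_ d d0) [n0 _ hn0].
(* [p.+1] enters because [ratio_sandwich] wants the lower block to be at least P = p+1, which
   [ltn_block] gives once n is that large. *)
exists (block p (maxn n0 p.+1)) => // N /= n0N.
have N0 : (0 < N)%N by rewrite (leq_trans _ n0N)// block_gt0.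
have [n /andP[nN Nn]] := exists_block p N0.
have mono i j : (i <= j)%N -> (block p i <= block p j)%N.
  move=> /subnK <-; elim: (j - i)%N => // l IH.
  by apply: leq_trans IH _; rewrite addSn ltnW// block_ltS.
have n0n : (maxn n0 p.+1 <= n)%N.
  rewrite leqNgt; apply/negP => /mono h.
  by have := leq_trans h n0N; rewrite leqNgt Nn.
move: n0n; rewrite geq_max => /andP[n0n pn].
have := hn0 _ n0n; have := hn0 _ (leqW n0n); rewrite /= => {hn0}.
have K0 := blockr_gt0 R p n; have K1 := blockr_gt0 R p n.+1.
have S1 : S N <= S (block p n.+1) by exact/ndS/ltnW.
have S2 : S (block p n) <= S N by exact: ndS.
have NK : (block p n)%:R <= N%:R :> R by rewrite ler_nat.
have NK1 : N%:R <= (block p n.+1)%:R :> R by rewrite ler_nat ltnW.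
have pK : p.+1%:R <= (block p n)%:R :> R.
  by rewrite ler_nat (leq_trans pn)// ltnW// ltn_block.
have := blockS_le R p n.
rewrite -(natr1 p.+1) => KK' h' h.
apply: (ratio_sandwich m0 d0 d1 de _ pe pK NK NK1 KK' _ S2 S1 h' h) => //.
Qed.

(** * Moments under pairwise independence *)

Section independence.
Variables (R : realType) (d : measure_display) (Omega : measurableType d).
Variable P : probability Omega R.

Definition independent2 (X Y : Omega -> R) := forall A B : set R,
  measurable A -> measurable B ->
  (P (X @^-1` A `&` Y @^-1` B) = P (X @^-1` A) * P (Y @^-1` B))%E.

Lemma independent2_comp (X Y : Omega -> R) (f g : R -> R) :
  measurable_fun setT f -> measurable_fun setT g ->
  independent2 X Y -> independent2 (f \o X) (g \o Y).
Proof.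
move=> mf mg XY A B mA mB; apply: (XY (f @^-1` A) (g @^-1` B)).
- by rewrite -[X in measurable X]setTI; exact: mf.
- by rewrite -[X in measurable X]setTI; exact: mg.
Qed.

(** By independence the law of the pair agrees with the product of the laws on rectangles, hence
    everywhere; Tonelli then factors the integral. *)
Lemma ge0_integral_independentM (X Y : {RV P >-> R}) :
  independent2 X Y -> (forall w, 0 <= X w) -> (forall w, 0 <= Y w) ->
  (\int[P]_w (X w * Y w)%:E = \int[P]_w (X w)%:E * \int[P]_w (Y w)%:E)%E.
Proof.
move=> XY X0 Y0.
have mXY : measurable_fun setT (fun w => (X w, Y w)) by exact: measurable_fun_pair.
pose Z : {RV P >-> (R * R)%type} := mfun_Sub (mem_set mXY).
(* Absolute values make the integrand nonnegative on the whole plane, as Tonelli requires; on the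
   range of the pair they change nothing. *)
pose g (z : R * R) : \bar R := (`|z.1| * `|z.2|)%:E.
have mg : measurable_fun setT g.
  by apply/measurable_EFinP; apply: measurable_funM; exact: measurableT_comp.
have mn : measurable_fun [set: R] (fun x : R => (`|x|)%:E).
  by apply/measurable_EFinP; exact: normr_measurable.
have g0 z : (0 <= g z)%E by rewrite lee_fin mulr_ge0.
transitivity (\int[P]_w (g \o Z) w)%E.
  by apply: eq_integral => w _; rewrite /= /g /= !ger0_norm.
rewrite -ge0_integral_distribution//.
rewrite -(@eq_measure_integral _ _ _ _ (distribution P Z)
  (distribution P X \x distribution P Y)%E); last first.
  move=> A mA _; apply: product_measure_unique => // B C mB mC; exact: XY.
rewrite fubini_tonelli1//=.
rewrite /fubini_F /g /=.
under eq_integral.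
  move=> x _; under eq_integral do rewrite EFinM.
  rewrite ge0_integralZl//.
  rewrite ge0_integral_distribution//.
  rewrite muleC; over.
rewrite /= ge0_integralZl//; last by apply: integral_ge0 => w _; rewrite lee_fin.
rewrite ge0_integral_distribution//.
rewrite muleC; congr (_ * _)%E; apply: eq_integral => w _ /=; by rewrite ger0_norm.
Qed.

Lemma bounded_Lfun2 (X : {RV P >-> R}) K : (forall w, `|X w| <= K) ->
  (X : Omega -> R) \in Lfun P 2%:E.
Proof.
move=> XK; rewrite inE; apply/andP; split; rewrite inE//=.
rewrite /finite_norm unlock /Lnorm poweR_lty//.
rewrite (@le_lt_trans _ _ (\int[P]_x (K `^ 2)%:E)%E)//; last first.
  by rewrite integral_cst//= probability_setT mule1 ltry.
apply: ge0_le_integral => //.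
- by move=> w _; rewrite lee_fin powR_ge0.
- apply/measurable_EFinP/(@measurableT_comp _ _ _ _ _ _ (@powR R ^~ 2)) => //.
  exact: measurableT_comp.
- by move=> w _; rewrite lee_fin ge0_ler_powR// nnegrE// (le_trans _ (XK w)).
Qed.

Lemma independent2_covariance (X Y : {RV P >-> R}) K :
  independent2 X Y -> (forall w, 0 <= X w <= K) -> (forall w, 0 <= Y w <= K) ->
  covariance P X Y = 0%E.
Proof.
move=> XY XK YK.
have X2 : (X : Omega -> R) \in Lfun P 2%:E.
  by apply: (@bounded_Lfun2 X K) => w; have /andP[? ?] := XK w; rewrite ger0_norm.
have Y2 : (Y : Omega -> R) \in Lfun P 2%:E.
  by apply: (@bounded_Lfun2 Y K) => w; have /andP[? ?] := YK w; rewrite ger0_norm.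
have Pfin : P setT \is a fin_num := fin_num_measure P _ measurableT.
have X1 := Lfun_subset12 Pfin X2.
have Y1 := Lfun_subset12 Pfin Y2.
rewrite covarianceE ?Lfun2_mul_Lfun1//.
have -> : ('E_P[(X : Omega -> R) * Y] = 'E_P[X] * 'E_P[Y])%E.
  rewrite unlock; apply: ge0_integral_independentM => // w.
    by have /andP[] := XK w.
  by have /andP[] := YK w.
by rewrite subee// fin_numM// expectation_fin_num.
Qed.

(** Pairwise independence suffices, because only covariances of pairs occur. The bound [K] secures
    square integrability, so that these covariances exist and vanish. *)
Lemma variance_sum_independent (Y : nat -> {RV P >-> R}) K (v : \bar R) n :
  (forall i j, i != j -> independent2 (Y i) (Y j)) ->
  (forall i w, 0 <= Y i w <= K) -> (forall i, 'V_P[Y i] <= v)%E ->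
  ('V_P[(fun w => \sum_(i < n) Y i w)%R] <= n%:R%:E * v)%E.
Proof.
move=> ind YK Yv.
have Y2 i : (Y i : Omega -> R) \in Lfun P 2%:E.
  by apply: (@bounded_Lfun2 (Y i) K) => w; have /andP[? ?] := YK i w; rewrite ger0_norm.
have SE m : (fun w => \sum_(i < m.+1) Y i w)%R = (fun w => \sum_(i < m) Y i w)%R \+ Y m.
  by apply/funext => w; rewrite big_ord_recr.
have S0 : (fun w => \sum_(i < 0) Y i w)%R = cst 0.
  by apply/funext => w; rewrite big_ord0.
have S2 m : (fun w => \sum_(i < m) Y i w)%R \in Lfun P 2%:E.
  elim: m => [|m IH]; first by rewrite S0 Lfun_cst.
  by rewrite SE rpredD ?lee1n.
elim: n => [|n IH]; first by rewrite S0 variance_cst mul0e.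
rewrite SE varianceD//.
have cov0 m : (m <= n)%N -> covariance P (fun w => \sum_(i < m) Y i w)%R (Y n) = 0%E.
  elim: m => [|m IHm] mn; first by rewrite S0 covariance_cst_l.
  rewrite SE covarianceDl// IHm ?(ltnW mn)// add0e.
  by apply: (@independent2_covariance _ _ K) => //; apply: ind; rewrite ltn_eqF.
rewrite cov0// mule0 adde0 -natr1 EFinD ge0_muleDl ?lee_fin// mul1e.
exact: leeD.
Qed.
End independence.

(** * Truncation and its cost along the blocks *)

Section truncation.
Variables (R : realType).

Definition trunc (k x : R) : R := x * \1_[set y | y <= k] x.
Definition exceeds (k x : R) : R := \1_[set y | k < y] x.

Lemma truncE k x : trunc k x = if x <= k then x else 0.
Proof.
rewrite /trunc indicE; case: ifPn => xk; first by rewrite mem_set// mulr1.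
by rewrite memNset ?mulr0//; exact/negP.
Qed.

Lemma exceedsE k x : exceeds k x = if k < x then 1 else 0.
Proof.
rewrite /exceeds indicE; case: ifPn => xk; first by rewrite mem_set.
by rewrite memNset//; exact/negP.
Qed.

Lemma measurable_trunc k : measurable_fun [set: R] (trunc k).
Proof.
apply: measurable_funM => //; apply: measurable_indic.
rewrite [X in measurable X](_ : _ = `]-oo, k]%classic); first exact: measurable_itv.
by apply/seteqP; split => x /=; rewrite in_itv.
Qed.

Lemma measurable_exceeds k : measurable_fun [set: R] (exceeds k).
Proof.
apply: measurable_indic.
rewrite [X in measurable X](_ : _ = `]k, +oo[%classic); first exact: measurable_itv.
by apply/seteqP; split => x /=; rewrite in_itv/= andbT.
Qed.

Lemma trunc_bound k x : 0 <= x -> 0 <= k -> 0 <= trunc k x <= k.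
Proof. by move=> x0 k0; rewrite truncE; case: ifP => [->|]; rewrite ?x0 ?lexx. Qed.

(** At level k a value x costs x^2/k if x <= k and k otherwise. Summed over geometrically growing k,
    both parts are linear in x, which is why a finite mean suffices for the strong law. *)
Lemma sum_block_cost p (x : R) N : 0 <= x ->
  \sum_(n < N) (trunc (block p n)%:R x ^+ 2 / (block p n)%:R +
                (block p n)%:R * exceeds (block p n)%:R x) <= 2 * p.+2%:R * x.
Proof.
move=> x0; rewrite big_split /= -mulrA mulr_natl mulr2n.
apply: lerD.
  apply: le_trans (sum_block_above p N x0); rewrite [leRHS]big_mkcond /=.
  apply: ler_sum => i _; rewrite truncE; case: ifP => // _.
  by rewrite expr0n mul0r.
apply: le_trans (sum_block_below p N x0); rewrite [leRHS]big_mkcond /=.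
apply: ler_sum => i _; rewrite exceedsE; case: ifP => // _; by rewrite ?mulr1 ?mulr0.
Qed.
End truncation.

(** * Strong law for pairwise independent nonnegative variables *)

Section strong_law.
Variables (R : realType) (d : measure_display) (Omega : measurableType d).
Variables (P : probability Omega R) (X : nat -> {RV P >-> R}) (m : R).
Hypothesis X0 : forall i w, 0 <= X i w.
Hypothesis Xind : forall i j, i != j -> independent2 P (X i) (X j).
Hypothesis Xid : identically_distributed X.
Hypothesis Xm : (\int[P]_w (X 0%N w)%:E = m%:E)%E.

Let integral_id (f : R -> R) i : measurable_fun [set: R] f -> (forall x, 0 <= f x) ->
  (\int[P]_w (f (X i w))%:E = \int[P]_w (f (X 0%N w))%:E)%E.
Proof.
move=> mf f0.
have E j : (\int[P]_w (f (X j w))%:E = \int[distribution P (X j)]_x (f x)%:E)%E.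
  by rewrite ge0_integral_distribution//; exact/measurable_EFinP.
rewrite !E; apply: eq_measure_integral => A mA _; exact: Xid.
Qed.

Let mcomp (f : R -> R) (i : nat) : measurable_fun [set: R] f ->
  measurable_fun [set: Omega] (fun w => f (X i w)).
Proof. by move=> mf; exact: measurableT_comp. Qed.

Let m0 : 0 <= m.
Proof. by rewrite -lee_fin -Xm integral_ge0// => w _; rewrite lee_fin. Qed.

Definition row_mean (k : nat) : R := fine (\int[P]_w (trunc k%:R (X 0%N w))%:E)%E.

Definition row_dev (k : nat) (w : Omega) : R :=
  (\sum_(i < k) trunc k%:R (X i w)) / k%:R - row_mean k.

(** This is an integer count, so it vanishes as soon as it is below 1, and then the truncated row
    sum is the true one. *)
Definition row_exceed (k : nat) (w : Omega) : R :=
  \sum_(i < k) exceeds k%:R (X i w).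

Let Y k (i : nat) : {RV P >-> R} :=
  mfun_Sub (mem_set (mcomp i (measurable_trunc (k%:R : R)))).

Let Y_bound k i w : 0 <= Y k i w <= k%:R.
Proof. exact: trunc_bound. Qed.

Let Y_int k i : (\int[P]_w (trunc k%:R (X i w))%:E = (row_mean k)%:E)%E.
Proof.
pose f (x : R) := `|trunc k%:R x|.
have fE j : (\int[P]_w (trunc k%:R (X j w))%:E = \int[P]_w (f (X j w))%:E)%E.
  apply: eq_integral => w _; rewrite /f ger0_norm//.
  by have /andP[] := Y_bound k j w.
have mf : measurable_fun [set: R] f.
  apply: (@measurableT_comp _ _ _ _ _ _ (@Num.norm _ R)).
    exact: normr_measurable.
  exact: measurable_trunc.
rewrite fE integral_id//; last by move=> x; exact: normr_ge0.
rewrite -fE /row_mean fineK// ge0_fin_numE; last first.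
  by apply: integral_ge0 => w _; rewrite lee_fin; have /andP[] := Y_bound k 0 w.
apply: (@le_lt_trans _ _ (\int[P]_w (k%:R)%:E)%E); last first.
  by rewrite integral_cst//= probability_setT mule1 ltry.
apply: ge0_le_integral => //.
- by move=> w _; rewrite lee_fin; have /andP[] := Y_bound k 0 w.
- by apply/measurable_EFinP/mcomp; exact: measurable_trunc.
- by move=> w _; rewrite lee_fin; have /andP[] := Y_bound k 0 w.
Qed.

(** The truncated variables are bounded and pairwise independent, so the variance of their average
    is at most 1/k times a single second moment. *)
Lemma row_dev_bound k : (0 < k)%N ->
  (\int[P]_w (row_dev k w ^+ 2)%:E <=
   \int[P]_w (trunc k%:R (X 0%N w) ^+ 2 / k%:R)%:E)%E.
Proof.
move=> k0.
have Y2 i : (Y k i : Omega -> R) \in Lfun P 2%:E.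
  apply: (@bounded_Lfun2 _ _ _ _ (Y k i) k%:R) => w.
  by have /andP[? ?] := Y_bound k i w; rewrite ger0_norm.
pose s := (\int[P]_w (trunc k%:R (X 0%N w) ^+ 2)%:E)%E.
have Yv i : ('V_P[Y k i] <= s)%E.
  rewrite varianceE//; apply: (@le_trans _ _ ('E_P[(Y k i : Omega -> R) ^+ 2])%E).
    by rewrite leeBlDr ?fin_numX ?expectation_fin_num ?leeDl ?sqre_ge0 ?Lfun_subset12
         ?fin_num_measure//.
  rewrite unlock /s -(@integral_id (fun x => trunc k%:R x ^+ 2) i)//.
  - by apply: measurable_funX; exact: measurable_trunc.
  - by move=> x; exact: sqr_ge0.
have YV : ('V_P[(fun w => \sum_(i < k) Y k i w)%R] <= k%:R%:E * s)%E.
  apply: (@variance_sum_independent _ _ _ _ _ k%:R) => // i j ij.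
  apply: (@independent2_comp _ _ _ _ _ _ (trunc k%:R) (trunc k%:R)); last exact: Xind.
    exact: measurable_trunc.
  exact: measurable_trunc.
have SE : ('E_P[(fun w => \sum_(i < k) Y k i w)%R] = (k%:R * row_mean k)%:E)%E.
  rewrite unlock; under eq_integral do rewrite -sumEFin.
  rewrite ge0_integral_sum//=; last 2 first.
  - by move=> i; apply/measurable_EFinP/mcomp; exact: measurable_trunc.
  - by move=> i w _; rewrite lee_fin; have /andP[] := Y_bound k i w.
  under eq_bigr do rewrite Y_int.
  by rewrite sumEFin sumr_const card_ord mulr_natl.
have kr0 : (0 : R) < k%:R by rewrite ltr0n.
have devE : (\int[P]_w (row_dev k w ^+ 2)%:E =
    (k%:R ^- 2)%:E * 'V_P[(fun w => \sum_(i < k) Y k i w)%R])%E.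
  rewrite /variance unlock SE /= [in RHS]unlock -ge0_integralZl//=; last 2 first.
  - apply/measurable_EFinP.
    have mS : measurable_fun [set: Omega] (fun w => \sum_(i < k) Y k i w).
      by apply: measurable_sum => i.
    by apply: measurable_funM; apply: measurable_funB.
  - by move=> w _; rewrite lee_fin -expr2 sqr_ge0.
  apply: eq_integral => w _; rewrite -EFinM; congr _%:E.
  rewrite /row_dev /= fctE /=; field; by rewrite gt_eqF.
rewrite devE; apply: (@le_trans _ _ ((k%:R ^- 2)%:E * (k%:R%:E * s))%E).
  by rewrite lee_wpmul2l// lee_fin invr_ge0 sqr_ge0.
rewrite muleA -EFinM /s.
have -> : k%:R ^- 2 * k%:R = k%:R^-1 :> R by field; rewrite gt_eqF.
rewrite -ge0_integralZl//=; last 2 first.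
- apply/measurable_EFinP; apply: measurable_funX; apply: mcomp; exact: measurable_trunc.
- by move=> w _; rewrite lee_fin sqr_ge0.
rewrite le_eqVlt; apply/orP; left; apply/eqP; apply: eq_integral => w _.
by rewrite -EFinM mulrC.
Qed.

Lemma row_exceed_int k :
  (\int[P]_w (row_exceed k w)%:E =
   \int[P]_w (k%:R * exceeds k%:R (X 0%N w))%:E)%E.
Proof.
have e0 x : 0 <= exceeds k%:R x :> R by rewrite exceedsE; case: ifP.
under eq_integral do rewrite /row_exceed -sumEFin.
rewrite ge0_integral_sum//=; last 2 first.
- by move=> i; apply/measurable_EFinP/mcomp; exact: measurable_exceeds.
- by move=> i w _; rewrite lee_fin.
rewrite (eq_bigr (fun=> \int[P]_w (exceeds k%:R (X 0%N w))%:E))%E; last first.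
  by move=> i _; rewrite integral_id//; exact: measurable_exceeds.
rewrite big_const_ord iter_addr_0.
under [RHS]eq_integral do rewrite EFinM.
rewrite ge0_integralZl//=; last 2 first.
- by apply/measurable_EFinP/mcomp; exact: measurable_exceeds.
- by move=> w _; rewrite lee_fin.
by rewrite mule_natl.
Qed.

(** Identical distribution moves every term onto [X 0]. Exchanging sum and integral leaves the
    expectation of a pointwise cost, at most [2 * p.+2%:R * X 0] by [sum_block_cost]. *)
Lemma block_cost_fin p :
  (\sum_(n <oo) \int[P]_w (row_dev (block p n) w ^+ 2 + row_exceed (block p n) w)%:E
   < +oo)%E.
Proof.
pose q n (x : R) : R := trunc (block p n)%:R x ^+ 2 / (block p n)%:R +
                (block p n)%:R * exceeds (block p n)%:R x.
have e0 k x : 0 <= exceeds k x :> R by rewrite exceedsE; case: ifP.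
have mq n : measurable_fun [set: R] (q n).
  apply: measurable_funD; apply: measurable_funM => //.
    by apply: measurable_funX; exact: measurable_trunc.
  exact: measurable_exceeds.
have q0 n x : 0 <= q n x by rewrite addr_ge0// ?divr_ge0 ?sqr_ge0// mulr_ge0.
have mdev k : measurable_fun [set: Omega] (fun w => row_dev k w ^+ 2).
  apply: measurable_funX; apply: measurable_funB => //; apply: measurable_funM => //.
  by apply: measurable_sum => i; apply: mcomp; exact: measurable_trunc.
have mexc k : measurable_fun [set: Omega] (row_exceed k).
  by apply: measurable_sum => i; apply: mcomp; exact: measurable_exceeds.
have exc0 k w : 0 <= row_exceed k w by apply: sumr_ge0.
apply: (@le_lt_trans _ _ (\sum_(n <oo) \int[P]_w (q n (X 0%N w))%:E)%E).
  apply: lee_nneseries => [n _ _|n _].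
    by apply: integral_ge0 => w _; rewrite lee_fin addr_ge0 ?sqr_ge0.
  under eq_integral do rewrite EFinD.
  rewrite ge0_integralD//=; last 4 first.
  - by move=> w _; rewrite lee_fin sqr_ge0.
  - exact/measurable_EFinP.
  - by move=> w _; rewrite lee_fin.
  - exact/measurable_EFinP.
  under [leRHS]eq_integral do rewrite EFinD.
  rewrite [leRHS]ge0_integralD//=; last 4 first.
  - by move=> w _; rewrite lee_fin divr_ge0 ?sqr_ge0.
  - apply/measurable_EFinP; apply: measurable_funM => //.
    by apply: measurable_funX; apply: mcomp; exact: measurable_trunc.
  - by move=> w _; rewrite lee_fin mulr_ge0.
  - apply/measurable_EFinP; apply: measurable_funM => //.
    by apply: mcomp; exact: measurable_exceeds.
  by rewrite row_exceed_int leeD2r// row_dev_bound// block_gt0.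
rewrite -integral_nneseries//; last 2 first.
- by move=> n; apply/measurable_EFinP; exact: mcomp.
- by move=> n w _; rewrite lee_fin.
apply: (@le_lt_trans _ _ (\int[P]_w ((2 * p.+2%:R)%:E * (X 0%N w)%:E))%E).
  apply: ge0_le_integral => //.
  - by move=> w _; apply: nneseries_ge0 => n _ _; rewrite lee_fin.
  - apply: ge0_emeasurable_sum => [n w _ _|n _]; first by rewrite lee_fin.
    by apply/measurable_EFinP; exact: mcomp.
  - by apply: measurable_funeM; exact/measurable_EFinP.
  - move=> w _; apply: lime_le; first by apply: is_cvg_nneseries => n _ _; rewrite lee_fin.
    apply: nearW => N; rewrite sumEFin -EFinM lee_fin big_mkord.
    exact: sum_block_cost.
rewrite ge0_integralZl//=; last 2 first.
- exact/measurable_EFinP.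
- by move=> w _; rewrite lee_fin.
by rewrite Xm -EFinM ltry.
Qed.

(** Dominated convergence with majorant [X 0]: at a fixed outcome the truncation is inactive once k
    passes the value. *)
Lemma row_mean_cvg : row_mean k @[k --> \oo] --> m.
Proof.
have : (\int[P]_w (trunc k%:R (X 0%N w))%:E)%E @[k --> \oo] --> (\int[P]_w (X 0%N w)%:E)%E.
  apply: (@dominated_cvg _ _ _ P setT measurableT
    (fun k w => (trunc k%:R (X 0%N w))%:E) (fun w => (X 0%N w)%:E) (fun w => (X 0%N w)%:E)).
  - by move=> k; apply/measurable_EFinP/mcomp; exact: measurable_trunc.
  - move=> w _; apply/fine_cvgP; split; first exact: nearW.
    apply: cvg_near_cst; exists (Num.bound (X 0%N w)) => // k /= hk.
    rewrite truncE ifT// (le_trans (ltW (archi_boundP (X0 _ _))))// ler_nat//.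
  - by [].
  - apply/integrableP; split; first exact/measurable_EFinP.
    under eq_integral do rewrite gee0_abs ?lee_fin//.
    by rewrite Xm ltry.
  - move=> k w _; rewrite gee0_abs ?lee_fin truncE; case: ifP => //.
rewrite Xm => /fine_cvgP[_]; exact.
Qed.

(** A nonnegative series with finite expectation is almost surely finite, so its terms tend to 0.
    This removes the deviation of the truncated averages and, eventually, every value above its
    truncation level. *)
Lemma strong_law_block p :
  {ae P, forall w, (\sum_(i < block p n) X i w) / (block p n)%:R @[n --> \oo] --> m}.
Proof.
pose g n w := row_dev (block p n) w ^+ 2 + row_exceed (block p n) w.
have e0 k x : 0 <= exceeds k x :> R by rewrite exceedsE; case: ifP.
have exc0 k w : 0 <= row_exceed k w by apply: sumr_ge0.
have g0 n w : 0 <= g n w by rewrite addr_ge0 ?sqr_ge0.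
have mg n : measurable_fun [set: Omega] (g n).
  apply: measurable_funD.
    apply: measurable_funX; apply: measurable_funB => //; apply: measurable_funM => //.
    by apply: measurable_sum => i; apply: mcomp; exact: measurable_trunc.
  by apply: measurable_sum => i; apply: mcomp; exact: measurable_exceeds.
have mG : measurable_fun [set: Omega] (fun w => \sum_(n <oo) (g n w)%:E)%E.
  apply: ge0_emeasurable_sum => [n w _ _|n _]; first by rewrite lee_fin.
  exact/measurable_EFinP.
have iG : P.-integrable setT (fun w => \sum_(n <oo) (g n w)%:E)%E.
  apply/integrableP; split => //.
  under eq_integral.
    move=> w _; rewrite gee0_abs; last by apply: nneseries_ge0 => n _ _; rewrite lee_fin.
    over.
  rewrite integral_nneseries//; last 2 first.
  - by move=> n; exact/measurable_EFinP.
  - by move=> n w _; rewrite lee_fin.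
  exact: block_cost_fin.
have := integrable_ae measurableT iG; apply: filterS => w /(_ I) Gfin.
have gto0 : g n w @[n --> \oo] --> 0.
  apply: cvg_series_cvg_0; apply: nondecreasing_is_cvgn.
    by apply: nondecreasing_series => n _ _; exact: g0.
  exists (fine (\sum_(n <oo) (g n w)%:E)%E) => _ [n _ <-].
  rewrite -lee_fin fineK// /series /= -sumEFin.
  by apply: nneseries_lim_ge => k _ _; rewrite lee_fin.
have dev0 : row_dev (block p n) w @[n --> \oo] --> 0.
  apply/cvgr0Pnorm_lt => e e_gt0; move/cvgr0Pnorm_lt : gto0 => /(_ (e ^+ 2)).
  rewrite exprn_gt0// => /(_ isT); apply: filterS => n.
  rewrite ger0_norm// => h; rewrite -(@ltr_pXn2r _ 2)// ?nnegrE ?(ltW e_gt0)//.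
  by rewrite -normrX ger0_norm ?sqr_ge0// (le_lt_trans _ h)// lerDl.
have blocky : block p @ \oo --> \oo.
  move=> A [N _ NA]; exists N => // n /= Nn; apply: NA => /=.
  by rewrite (leq_trans Nn)// ltnW// ltn_block.
have mean_m : row_mean (block p n) @[n --> \oo] --> m.
  exact: (cvg_comp _ _ blocky row_mean_cvg).
rewrite -[m]add0r; apply: cvg_trans (cvgD dev0 mean_m); apply: near_eq_cvg.
move/cvgr0Pnorm_lt : gto0 => /(_ 1 ltr01); apply: filterS => n.
rewrite ger0_norm// => gn1; rewrite /= /row_dev subrK; congr (_ / _).
apply: eq_bigr => i _; rewrite truncE; case: ifPn => //; rewrite -ltNge => hi.
(* A value above the truncation level would add 1 to [row_exceed], against [g n w < 1]. *)
suff : 1 <= g n w by rewrite leNgt gn1.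
rewrite (@le_trans _ _ (row_exceed (block p n) w))// ?lerDr ?sqr_ge0//.
rewrite /row_exceed (bigD1 i)//= exceedsE hi lerDl; exact: sumr_ge0.
Qed.

(* Etemadi's argument: truncating the k-th row at k makes the variances summable along a
   geometric sequence of k although only the mean is finite, and monotonicity of the
   partial sums fills the gaps between consecutive blocks. *)
Theorem strong_law_nonneg :
  {ae P, forall w, (\sum_(i < n) X i w) / n%:R @[n --> \oo] --> m}.
Proof.
have := ae_foralln strong_law_block; apply: filterS => w h.
apply: (@cvg_mean_of_blocks _ (fun n => \sum_(i < n) X i w)) => //.
- apply/nondecreasing_seqP => n; by rewrite big_ord_recr /= lerDl.
- by move=> n; apply: sumr_ge0.
Qed.
End strong_law.

(** * Strong laws for the life times and their squares *)

Section renewal_laws.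
Variables (R : realType) (d : measure_display) (Omega : measurableType d).
Variables (P : probability Omega R).

Lemma mutually_independent2 (X : nat -> {RV P >-> R}) i j :
  mutually_independent X -> i != j -> independent2 P (X i) (X j).
Proof.
move=> Xind ij A B mA mB.
have := Xind [:: i; j] (fun k => if k == i then A else B).
rewrite /= inE ij => /(_ isT) h.
have {}h := h (fun k => if k == i as b return measurable (if b then A else B) then mA else mB).
rewrite big_cons big_seq1 eqxx eq_sym (negbTE ij) in h.
rewrite -h; congr (P _); apply/seteqP; split => w.
  move=> [Aw Bw] k /=; rewrite !inE => /orP[|] /eqP ->; first by rewrite eqxx.
  by rewrite eq_sym (negbTE ij).
move=> /= hw; split.
  by have := hw i; rewrite /= inE eqxx => /(_ isT).
by have := hw j; rewrite /= !inE eqxx orbT eq_sym (negbTE ij) => /(_ isT).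
Qed.

(** The second law is the first one for the squared life times; their common mean is recovered from
    the variance. *)
Lemma renewal_strong_laws (xi : nat -> {RV P >-> R}) (mu sigma2 : R) :
  renewal_process xi mu sigma2 ->
  {ae P, forall w,
    (\sum_(i < n) xi i w) / n%:R @[n --> \oo] --> mu /\
    (\sum_(i < n) xi i w ^+ 2) / n%:R @[n --> \oo] --> mu ^+ 2 + sigma2}.
Proof.
case=> xi0 xiind xiid xi2 ximean xivar.
have msq i : measurable_fun [set: Omega] (fun w => xi i w ^+ 2) by exact: measurable_funX.
pose xisq i : {RV P >-> R} := mfun_Sub (mem_set (msq i)).
have ind i j : i != j -> independent2 P (xi i) (xi j).
  exact: mutually_independent2.
have law1 := @strong_law_nonneg _ _ _ P xi mu (fun i w => ltW (xi0 i w)) ind xiid.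
have law2 := @strong_law_nonneg _ _ _ P xisq (mu ^+ 2 + sigma2).
have E1 : (\int[P]_w (xi 0%N w)%:E = mu%:E)%E by rewrite -(ximean 0%N) unlock.
have E2 : (\int[P]_w (xisq 0%N w)%:E = (mu ^+ 2 + sigma2)%:E)%E.
  have := varianceE (xi2 0%N); rewrite xivar ximean => h.
  have : ('E_P[(xi 0%N : Omega -> R) ^+ 2] = sigma2%:E + mu%:E ^+ 2)%E.
    by rewrite h subeK.
  by rewrite unlock addrC EFinD => <-.
have sq_ind i j : i != j -> independent2 P (xisq i) (xisq j).
  move=> ij; have := ind i j ij.
  by apply: (@independent2_comp _ _ _ _ _ _ (fun x => x ^+ 2) (fun x => x ^+ 2)).
have sq_id : identically_distributed xisq.
  move=> i j B mB.
  have := xiid i j ((fun x : R => x ^+ 2) @^-1` B); apply.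
  have msq1 : measurable_fun [set: R] (fun x : R => x ^+ 2) by exact: measurable_funX.
  by rewrite -[X in measurable X]setTI; exact: msq1.
have := law2 (fun i w => sqr_ge0 _) sq_ind sq_id E2.
by have := law1 E1; apply: filterS2 => w h1 h2; split.
Qed.
End renewal_laws.

(** * Counting events of a single path *)

Section event_sequences.
Variables (R : realType).
Implicit Types (F : nat -> R) (u v M : R).

(** Index 0 is the origin and not an event, so [F j] is the j-th event and [F j.+1 - F j] is life
    time number j+1. *)
Definition event_seq F : Prop :=
  [/\ F 0%N = 0, (forall j, F j < F j.+1) & forall M, exists j, M < F j].

(** The counting process read off the sequence; the default 0 of [xget] serves negative times. *)
Definition rank F u : nat := xget 0%N [set j | F j <= u < F j.+1].

Variable F : nat -> R.
Hypothesis HF : event_seq F.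

Lemma event_seq_lt i j : (F i < F j) = (i < j)%N.
Proof.
have [_ incF _] := HF.
have h a b : (a < b)%N -> F a < F b.
  elim: b => // b IH; rewrite ltnS leq_eqVlt => /predU1P[->|/IH ab]; first exact: incF.
  exact: lt_trans ab (incF b).
have [/h ij|ji|->] := ltngtP i j; last by rewrite ltxx.
  by rewrite ij.
by apply/negbTE; rewrite -leNgt ltW// h.
Qed.

Lemma event_seq_le i j : (F i <= F j) = (i <= j)%N.
Proof. by rewrite leNgt event_seq_lt -leqNgt. Qed.

Lemma event_seq_gt0 j : (0 < j)%N -> 0 < F j.
Proof. by have [F0 _ _] := HF; rewrite -F0 event_seq_lt. Qed.

Lemma event_seq_ge0 j : 0 <= F j.
Proof. by have [F0 _ _] := HF; rewrite -F0 event_seq_le. Qed.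

Lemma rank_eq u j : F j <= u < F j.+1 -> rank F u = j.
Proof.
move=> /andP[h1 h2]; rewrite /rank; case: xgetP => [i _ /andP[g1 g2]|/(_ j)].
  apply/eqP; rewrite eqn_leq -ltnS -event_seq_lt (le_lt_trans g1 h2)/=.
  by rewrite -ltnS -event_seq_lt (le_lt_trans h1 g2).
by rewrite /= h1 h2.
Qed.

Lemma rankP u : 0 <= u -> F (rank F u) <= u < F (rank F u).+1.
Proof.
move=> u0; suff [j hj] : exists j, F j <= u < F j.+1 by rewrite (rank_eq hj).
have [F0 _ /(_ u)[n]] := HF; elim: n => [|n IH]; first by rewrite F0 ltNge u0.
by have [/IH//|Fn nF] := ltP u (F n); exists n; rewrite Fn.
Qed.

Lemma rank_lt0 u : u < 0 -> rank F u = 0%N.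
Proof.
move=> u0; rewrite /rank; case: xgetP => // j _ /andP[h _].
by have := le_lt_trans h u0; rewrite ltNge event_seq_ge0.
Qed.

Lemma rank_ge u j : 0 <= u -> (j <= rank F u)%N = (F j <= u).
Proof.
move=> /rankP /andP[h1 h2]; apply/idP/idP => h.
  by apply: le_trans h1; rewrite event_seq_le.
by rewrite -ltnS -event_seq_lt (le_lt_trans h h2).
Qed.

Lemma leq_rank u v : u <= v -> (rank F u <= rank F v)%N.
Proof.
move=> uv; have [/rank_lt0 -> //|u0] := ltP u 0.
rewrite rank_ge ?(le_trans u0)//; have /andP[h _] := rankP u0; exact: le_trans h uv.
Qed.

Lemma rank_right u : exists2 e, 0 < e & forall v, u <= v < u + e -> rank F v = rank F u.
Proof.
have [u0|u0] := ltP u 0.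
  exists (- u); rewrite ?oppr_gt0// => v /andP[_ vu].
  by rewrite !rank_lt0//; rewrite subrr in vu.
have /andP[h1 h2] := rankP u0.
exists (F (rank F u).+1 - u); first by rewrite subr_gt0.
move=> v /andP[uv vu]; apply: rank_eq; rewrite (le_trans h1 uv)/=.
by rewrite addrC subrK in vu.
Qed.

(** If u is itself an event, the value on its left differs from [rank F u]; hence the separate
    witness [j]. *)
Lemma rank_left u : exists2 e, 0 < e &
  exists j, forall v, u - e < v < u -> rank F v = j.
Proof.
have [u0|u0] := leP u 0.
  exists 1 => //; exists 0%N => v /andP[_ vu]; apply: rank_lt0; exact: lt_le_trans vu u0.
have /andP[h1 h2] := rankP (ltW u0).
move: h1; rewrite le_eqVlt => /predU1P[E|h1].
  case Er : (rank F u) => [|j].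
    by have [F0 _ _] := HF; rewrite Er F0 in E; rewrite -E ltxx in u0.
  exists (u - F j); first by rewrite subr_gt0 -E Er event_seq_lt.
  exists j => v /andP[uv vu]; apply: rank_eq.
  by rewrite -Er E vu andbT ltW//; rewrite opprB addrC subrK in uv.
exists (u - F (rank F u)); first by rewrite subr_gt0.
exists (rank F u) => v /andP[uv vu]; apply: rank_eq.
by rewrite (lt_trans vu h2) andbT ltW//; rewrite opprB addrC subrK in uv.
Qed.

Definition events_upto M : set R := [set F j | j in [set j : nat | (0 < j)%N]] `&` `]0, M].

(** Up to the horizon [M] the recursive infimum is attained at the next event; beyond it the infimum
    is over the empty set. *)
Lemma event_time_upto M j : 0 <= M ->
  event_time (events_upto M) j = if F j <= M then (F j)%:E else +oo%E.
Proof.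
move=> M0; have [F0 _ _] := HF.
elim: j => [|j IH] /=; first by rewrite F0 M0.
rewrite IH; have [jM|jM] := leP (F j) M; last first.
  have -> : [set x%:E | x in [set x | events_upto M x /\ (+oo < x%:E)%E]] = set0.
    by apply/seteqP; split => // y [x [_]]; rewrite ltNge leey.
  by rewrite ereal_inf0 ifF//; apply/negbTE; rewrite -ltNge (lt_trans jM)// event_seq_lt.
have [SM|SM] := leP (F j.+1) M.
  apply/eqP; rewrite eq_le; apply/andP; split.
    apply: ereal_inf_lbound; exists (F j.+1) => //; split;
      last by rewrite lte_fin event_seq_lt.
    by split; [exists j.+1|rewrite /= in_itv/= SM event_seq_gt0].
  apply: le_ereal_inf_tmp => _ [_ [[[i /= i0 <-] _]] +] <-.
  by rewrite lte_fin lee_fin event_seq_lt event_seq_le.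
have -> : [set x%:E | x in [set x | events_upto M x /\ ((F j)%:E < x%:E)%E]] = set0.
  apply/seteqP; split => // y [_ [[[i /= i0 <-]]]]; rewrite in_itv/= => /andP[_ iM].
  rewrite lte_fin event_seq_lt => ji _.
  by have := le_lt_trans iM SM; rewrite event_seq_lt ltnS leqNgt ji.
by rewrite ereal_inf0.
Qed.

Lemma counting_upto M u : 0 <= u <= M -> Defs.counting (events_upto M) u = rank F u.
Proof.
move=> /andP[u0 uM]; have M0 := le_trans u0 uM.
have J j : (event_time (events_upto M) j <= u%:E)%E = (j <= rank F u)%N.
  rewrite rank_ge// event_time_upto//; case: ifPn => [//|]; rewrite -ltNge => jM.
  by rewrite leNgt ltry/= leNgt (le_lt_trans uM jM).
rewrite /Defs.counting; case: xgetP => [j _ [[j0]]|].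
  rewrite J => jr jmax; apply/eqP; rewrite eqn_leq jr/=; apply: jmax; split.
    exact: leq_trans j0 jr.
  by rewrite J.
move=> /(_ (rank F u)); case: (posnP (rank F u)) => [->//|r0] []; split.
  by split=> //; rewrite J.
by move=> k [_]; rewrite J.
Qed.

Lemma life_time_upto M j : 0 <= M -> F j.+1 <= M ->
  life_time (events_upto M) j.+1 = F j.+1 - F j.
Proof.
move=> M0 jM; rewrite /life_time !event_time_upto// jM/= ifT//.
by rewrite (le_trans _ jM)// event_seq_le.
Qed.

Definition cumsq (k : nat) : R := \sum_(i < k) (F i.+1 - F i) ^+ 2.

Lemma cumsqS k : cumsq k.+1 = cumsq k + (F k.+1 - F k) ^+ 2.
Proof. by rewrite /cumsq big_ord_recr. Qed.

(** The estimator as a function of the event counts i and j at the two ends of the window. The life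
    time across the left end is left out, so life times i+2 to j telescope to [F j - F i.+1]. *)
Definition idx_mean (i j : nat) : R :=
  if (1 < j - i)%N then (F j - F i.+1) / (j%:R - i%:R - 1) else 0.

(** Expanding the square about the empirical mean leaves the sum of squares minus the number of
    summands times the squared mean. *)
Definition idx_var (i j : nat) : R :=
  if (2 < j - i)%N then
    (cumsq j - cumsq i.+1 - idx_mean i j ^+ 2 * (j%:R - i%:R - 1)) / (j%:R - i%:R - 2)
  else 0.

Lemma sum_window (f : nat -> R) (g : nat -> R) i j :
  (forall k, g k.+1 - g k = f k.+1) -> (i < j)%N ->
  \sum_(i.+2 <= k < j.+1) f k = g j - g i.+1.
Proof.
move=> fg ij; rewrite -(@telescope_sumr _ i.+1 j g)// big_add1 /=.
by apply: eq_bigr => k _; rewrite fg.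
Qed.

Lemma mu_hat_upto M a b : 0 <= a -> a <= b -> b <= M ->
  mu_hat (events_upto M) a b = idx_mean (rank F a) (rank F b).
Proof.
move=> a0 ab bM; have b0 := le_trans a0 ab; have M0 := le_trans b0 bM.
rewrite /mu_hat /window_count !counting_upto ?a0 ?b0 ?(le_trans ab)// /idx_mean.
case: ifP => // h; rewrite mulrC.
have ab' : (rank F a < rank F b)%N by lia.
have -> : (rank F b - rank F a - 1)%N%:R = (rank F b)%:R - (rank F a)%:R - 1 :> R.
  by rewrite natrB ?natrB//; [lia|lia].
congr (_ * _); rewrite -(sum_window (f := fun k => F k - F k.-1) (g := F))//.
apply: eq_big_nat => k /andP[k1 k2].
case: k k1 k2 => // k _ k2; rewrite life_time_upto//.
apply: le_trans bM; have /andP[h1 _] := rankP b0; apply: le_trans h1.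
by rewrite event_seq_le.
Qed.

Lemma sigma2_hat_upto M a b : 0 <= a -> a <= b -> b <= M ->
  sigma2_hat (events_upto M) a b = idx_var (rank F a) (rank F b).
Proof.
move=> a0 ab bM; have b0 := le_trans a0 ab; have M0 := le_trans b0 bM.
rewrite /sigma2_hat mu_hat_upto//.
rewrite /window_count !counting_upto ?a0 ?b0 ?(le_trans ab)// /idx_var.
case: ifP => // h; rewrite mulrC.
have ab' : (rank F a < rank F b)%N by lia.
have -> : (rank F b - rank F a - 2)%N%:R = (rank F b)%:R - (rank F a)%:R - 2 :> R.
  by rewrite natrB ?natrB//; [lia|lia].
congr (_ * _); set mm := idx_mean _ _.
(* This evaluates the linear term of the expanded square; more than 2 events in the window put
   [idx_mean] in its main branch. *)
have mmE : F (rank F b) - F (rank F a).+1 = mm * ((rank F b)%:R - (rank F a)%:R - 1).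
  rewrite /mm /idx_mean ifT; last by lia.
  rewrite divfK// -natrB; last by lia.
  by rewrite -(natrB _ (n := 1)) ?pnatr_eq0; lia.
transitivity (cumsq (rank F b) - cumsq (rank F a).+1 -
  2 * mm * (F (rank F b) - F (rank F a).+1) +
  mm ^+ 2 * ((rank F b)%:R - (rank F a)%:R - 1)); last by rewrite mmE; ring.
rewrite -(sum_window (f := fun k => F k - F k.-1) (g := F))//.
rewrite -(sum_window (f := fun k => (F k - F k.-1) ^+ 2) (g := cumsq))//; last first.
  by move=> k; rewrite cumsqS /= addrC addKr.
have -> : mm ^+ 2 * ((rank F b)%:R - (rank F a)%:R - 1) =
    \sum_((rank F a).+2 <= k < (rank F b).+1) mm ^+ 2.
  rewrite sumr_const_nat -[RHS]mulr_natr subSS; congr (_ * _).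
  by rewrite subnS -subn1 natrB ?natrB//; lia.
rewrite mulr_sumr -sumrB -big_split /=.
apply: eq_big_nat => k /andP[k1 k2].
case: k k1 k2 => // k _ k2; rewrite life_time_upto//; first by rewrite /=; ring.
apply: le_trans bM; have /andP[h1 _] := rankP b0; apply: le_trans h1.
by rewrite event_seq_le.
Qed.
End event_sequences.

(** * Pointwise limits along the compound path *)

Section linear_growth.
Variable R : realType.
Implicit Types (A : nat -> R) (a e u : R).

(** [C] absorbs the finitely many early indices, so the bound holds at every n and applies to
    indices that need not tend to infinity. *)
Lemma linear_growth_bound A a e : A n / n%:R @[n --> \oo] --> a -> 0 < e ->
  exists2 C, 0 <= C & forall n, `|A n - a * n%:R| <= e * n%:R + C.
Proof.
move=> /cvgrPdist_le Aa e0; have [N _ hN] := Aa e e0.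
exists (\sum_(i < N.+1) `|A i - a * i%:R|); first by apply: sumr_ge0.
move=> n; have [Nn|nN] := leqP N.+1 n; last first.
  by rewrite (bigD1 (Ordinal nN))//= addrCA lerDl addr_ge0 ?sumr_ge0// mulr_ge0// ltW.
have n0 : 0 < n%:R :> R by rewrite ltr0n (leq_trans _ Nn).
apply: (@le_trans _ _ (e * n%:R)); last by rewrite lerDl sumr_ge0.
have := hN n (ltnW Nn); rewrite /= -ler_pdivrMr// distrC => /(le_trans _); apply.
rewrite -[X in _ / X]gtr0_norm// -normf_div mulrBl mulfK ?gt_eqF//.
Qed.

Lemma cvg_divn (C : R) : C / n%:R @[n --> \oo] --> (0 : R).
Proof.
rewrite -(mulr0 C); apply: cvgMl_tmp; apply/cvgrPdist_le => e e0.
near=> n; rewrite sub0r normrN ger0_norm//.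
have n0 : 0 < n%:R :> R by near: n; exists 1%N => // n /=; rewrite ltr0n.
rewrite -[leLHS]mul1r ler_pdivrMr// -ler_pdivrMl//.
near: n; exists (Num.bound (e^-1 * 1)) => // n /= hn.
apply: le_trans (ltW (archi_boundP _)) _; last by rewrite ler_nat.
by rewrite mulr1 invr_ge0 ltW.
Unshelve. all: by end_near. Qed.

(** The case l = 0 is included, where [k n] may stay bounded; a bound valid at every index is
    therefore used in place of a composition of limits. *)
Lemma cvg_along A a (k : nat -> nat) (l : R) : A n / n%:R @[n --> \oo] --> a ->
  (k n)%:R / n%:R @[n --> \oo] --> l ->
  A (k n) / n%:R @[n --> \oo] --> a * l.
Proof.
move=> Aa kl.
suff h : (A (k n) - a * (k n)%:R) / n%:R @[n --> \oo] --> (0 : R).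
  have -> : (fun n => A (k n) / n%:R) =
     (fun n => (A (k n) - a * (k n)%:R) / n%:R + a * ((k n)%:R / n%:R)).
    by apply/funext => n; rewrite mulrA -mulrDl subrK.
  by rewrite -[a * l]add0r; apply: cvgD => //; exact: cvgMl_tmp.
apply/cvgr0Pnorm_le => e e0.
have l1 : 0 < `|l| + 1 by rewrite ltr_wpDl.
have d0 : 0 < e / 2 / (`|l| + 1) by rewrite !divr_gt0.
have [C C0 hC] := linear_growth_bound Aa d0.
near=> n.
have n0 : 0 < n%:R :> R by near: n; exists 1%N => // n /=; rewrite ltr0n.
have knl : (k n)%:R / n%:R <= `|l| + 1 :> R.
  have : `|l - (k n)%:R / n%:R| <= 1 by near: n; move/cvgrPdist_le : kl; exact.
  by rewrite ler_distlC => /andP[_ /le_trans]; apply; rewrite lerD2r ler_norm.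
have Cn : C / n%:R <= e / 2.
  have : `|0 - C / n%:R| <= e / 2.
    by near: n; move/cvgrPdist_le : (cvg_divn C); apply; rewrite divr_gt0.
  by rewrite sub0r normrN ger0_norm// divr_ge0.
rewrite normf_div (gtr0_norm n0) ler_pdivrMr//; apply: le_trans (hC _) _.
rewrite ler_pdivrMr// in knl; rewrite ler_pdivrMr// in Cn.
have -> : e * n%:R = e / 2 / (`|l| + 1) * ((`|l| + 1) * n%:R) + e / 2 * n%:R.
  by field; rewrite gt_eqF.
by apply: lerD => //; rewrite ler_pM2l.
Unshelve. all: by end_near. Qed.

Lemma partial_sums_event_seq (x : nat -> R) (mu : R) : 0 < mu -> (forall j, 0 < x j) ->
  (\sum_(i < n) x i) / n%:R @[n --> \oo] --> mu ->
  event_seq (fun n => \sum_(i < n) x i).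
Proof.
move=> mu0 x0 xmu; split; first by rewrite big_ord0.
  by move=> j; rewrite big_ord_recr /= ltrDl.
move=> M; have mu20 : 0 < mu / 2 by rewrite divr_gt0.
have [C C0 hC] := linear_growth_bound xmu mu20.
exists (Num.bound ((C + `|M|) / (mu / 2))); set n := Num.bound _.
have : (C + `|M|) / (mu / 2) < n%:R.
  by apply: archi_boundP; rewrite divr_ge0 ?addr_ge0// ltW.
rewrite ltr_pdivrMr// => h; have := hC n; rewrite ler_distl => /andP[h1 _].
have := ler_norm M; lra.
Qed.

(** The elementary renewal theorem on one path: n u lies between the events number r and r+1, which
    are close to mu r and mu (r+1). *)
Lemma rank_cvg (S : nat -> R) (mu u : R) : 0 < mu -> event_seq S ->
  S n / n%:R @[n --> \oo] --> mu ->
  (rank S (n%:R * u))%:R / n%:R @[n --> \oo] --> Num.max 0 u / mu.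
Proof.
move=> mu0 HS Smu; have [u0|u0] := ltP u 0.
  rewrite mul0r; apply: cvg_near_cst; exists 1%N => // n /= n0.
  by rewrite rank_lt0 ?mul0r// pmulr_rlt0// ltr0n.
(* The error is proportional to r, so r has to be bounded first: d <= mu/2 gives r <= 2 (n u + C) /
   mu. *)
have e_of d : 0 < d -> d <= mu / 2 -> exists D, forall n : nat,
    `|mu * (rank S (n%:R * u))%:R - n%:R * u| <= d * (2 * u / mu) * n%:R + D.
  move=> d0 dmu; have [C C0 hC] := linear_growth_bound Smu d0.
  exists (d * (2 * C / mu) + d + C + mu) => n.
  have nu0 : 0 <= n%:R * u by rewrite mulr_ge0.
  have := rankP HS nu0; set r := rank _ _ => /andP[h1 h2].
  have := hC r; have := hC r.+1; rewrite -(natr1 r) !ler_distl => /andP[_ g2] /andP[g1 _].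
  have r0 : 0 <= r%:R :> R by [].
  have hr : r%:R <= 2 * (n%:R * u + C) / mu.
    rewrite ler_pdivlMr//; nra.
  have hd : d * r%:R <= d * (2 * (n%:R * u + C) / mu) by rewrite ler_pM2l.
  have E : d * (2 * (n%:R * u + C) / mu) = d * (2 * u / mu) * n%:R + d * (2 * C / mu) by ring.
  rewrite E in hd; apply/andP; split; nra.
apply/cvgrPdist_le => e e0.
pose d := Num.min (mu / 2) (e / 2 * mu / (2 * u / mu + 1)).
have q0 : 0 <= 2 * u / mu by rewrite divr_ge0 ?mulr_ge0 ?(ltW mu0).
have d0 : 0 < d by rewrite lt_min !divr_gt0 ?mulr_gt0 ?divr_gt0// ltr_wpDl.
have dmu : d <= mu / 2 by rewrite ge_min lexx.
have de : d * (2 * u / mu) <= e / 2 * mu.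
  apply: (@le_trans _ _ (d * (2 * u / mu + 1))); first by rewrite ler_pM2l// lerDl.
  by rewrite -ler_pdivlMr ?ltr_wpDl// ge_min lexx orbT.
have [D hD] := e_of d d0 dmu.
near=> n.
have n0 : 0 < n%:R :> R by near: n; exists 1%N => // n /=; rewrite ltr0n.
have Dn : D / n%:R <= e / 2 * mu.
  have : `|0 - D / n%:R| <= e / 2 * mu.
    by near: n; move/cvgrPdist_le : (cvg_divn D); apply; rewrite mulr_gt0 ?divr_gt0.
  by rewrite sub0r normrN; apply: le_trans; exact: ler_norm.
rewrite ler_pdivrMr// in Dn.
have := hD n; set r := (rank _ _)%:R => {}hD.
have -> : u / mu - r / n%:R = - (mu * r - n%:R * u) / (mu * n%:R).
  by field; rewrite !gt_eqF.
rewrite normf_div normrN (gtr0_norm (mulr_gt0 mu0 n0)) ler_pdivrMr ?mulr_gt0//.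
apply: le_trans hD _.
have : d * (2 * u / mu) * n%:R <= e / 2 * mu * n%:R by rewrite ler_pM2r.
lra.
Unshelve. all: by end_near. Qed.
End linear_growth.

(** * Gluing two event sequences at a time [a] *)

Section splice.
Variables (R : realType) (S1 S2 : nat -> R) (a : R).
Hypotheses (HS1 : event_seq S1) (HS2 : event_seq S2) (a0 : 0 <= a).

(** The index in [S2] resumes from [rank S2 a], so the first event after the switch is the first one
    of [S2] past [a]. *)
Definition splice (j : nat) : R :=
  if (j <= rank S1 a)%N then S1 j else S2 (rank S2 a + (j - rank S1 a))%N.

Local Notation N1 := (rank S1 a).
Local Notation N2 := (rank S2 a).

Let S1a : S1 N1 <= a < S1 N1.+1. Proof. exact: rankP. Qed.
Let S2a : S2 N2 <= a < S2 N2.+1. Proof. exact: rankP. Qed.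

Lemma splice_left j : (j <= N1)%N -> splice j = S1 j.
Proof. by rewrite /splice => ->. Qed.

Lemma splice_right m : splice (N1 + m.+1) = S2 (N2 + m.+1).
Proof. by rewrite /splice ifF ?addKn//; lia. Qed.

Lemma splice_event_seq : event_seq splice.
Proof.
have [S10 inc1 _] := HS1; have [_ inc2 unb2] := HS2.
split; first by rewrite splice_left.
  move=> j; have [jN|Nj] := ltnP j N1; first by rewrite !splice_left ?(ltnW jN).
  have [m ->] : exists m, j = (N1 + m)%N by exists (j - N1)%N; lia.
  case: m => [|m]; last by rewrite -addnS !splice_right [X in _ < S2 X]addnS; exact: inc2.
  rewrite addn0 -addn1 splice_right splice_left// addn1.
  by have /andP[h _] := S1a; have /andP[_ h'] := S2a; exact: le_lt_trans h h'.
move=> M; have [j Mj] := unb2 M.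
exists (N1 + j.+1)%N; rewrite splice_right (lt_le_trans Mj)// event_seq_le//; lia.
Qed.

Lemma rank_splice_le u : u <= a -> rank splice u = rank S1 u.
Proof.
move=> ua; have HF := splice_event_seq.
have [u0|u0] := ltP u 0; first by rewrite !rank_lt0.
have /andP[h1 h2] := rankP HS1 u0.
have rN : (rank S1 u <= N1)%N by exact: leq_rank.
apply: rank_eq => //; rewrite splice_left// h1/=.
move: rN; rewrite leq_eqVlt => /predU1P[->|rN]; last by rewrite splice_left.
rewrite -addn1 splice_right addn1; have /andP[_ h'] := S2a; exact: le_lt_trans ua h'.
Qed.

Lemma rank_splice_ge u : a <= u -> rank splice u = (N1 + (rank S2 u - N2))%N.
Proof.
move=> au; have HF := splice_event_seq; have u0 := le_trans a0 au.
have /andP[h1 h2] := rankP HS2 u0.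
have rN : (N2 <= rank S2 u)%N by exact: leq_rank.
have [m mE] : exists m, rank S2 u = (N2 + m)%N by exists (rank S2 u - N2)%N; lia.
rewrite mE addKn; apply: rank_eq => //; rewrite -addnS splice_right.
rewrite addnS -mE h2 andbT; case: m mE => [|m] mE; last by rewrite splice_right -mE.
rewrite addn0 splice_left//; have /andP[h _] := S1a; exact: le_trans h au.
Qed.

Definition gap (F : nat -> R) j := F j.+1 - F j.

Lemma gap_ge0 F j : event_seq F -> 0 <= gap F j.
Proof. by case=> _ inc _; rewrite subr_ge0 ltW. Qed.

(** Each process has a life time that covers [a]; the glued one runs from the left end of the first
    to the right end of the second. *)
Lemma gap_splice_mid : gap splice N1 <= gap S1 N1 + gap S2 N2.
Proof.
rewrite /gap -addn1 splice_right splice_left// !addn1.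
have /andP[h _] := S1a; have /andP[_ h'] := S2a.
have /andP[_ g] := S1a; have /andP[g' _] := S2a; lra.
Qed.

Lemma gap_splice_left j : (j <= N1)%N -> gap splice j <= gap S1 j + (gap S1 N1 + gap S2 N2).
Proof.
rewrite leq_eqVlt => /predU1P[->|jN].
  by rewrite (le_trans gap_splice_mid)// lerDr gap_ge0.
by rewrite /gap !splice_left ?(ltnW jN)// lerDl addr_ge0 ?gap_ge0.
Qed.

Lemma gap_splice_right m :
  gap splice (N1 + m) <= gap S2 (N2 + m) + (gap S1 N1 + gap S2 N2).
Proof.
case: m => [|m]; first by rewrite !addn0 (le_trans gap_splice_mid)// lerDr gap_ge0.
by rewrite /gap -!addnS !splice_right lerDl addr_ge0 ?gap_ge0.
Qed.

Lemma cumsq_splice_left j : (j <= N1)%N -> cumsq splice j = cumsq S1 j.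
Proof.
move=> jN; apply: eq_bigr => i _; rewrite !splice_left//.
  by rewrite (leq_trans _ jN)// ltnW.
by rewrite (leq_trans _ jN).
Qed.

(** Past the junction the increments are those of [S2], except that the glued life time replaces the
    one of [S2] across [a]; only these two squares differ. *)
Lemma cumsq_splice_right m :
  `|cumsq splice (N1 + m) - (cumsq S1 N1 + (cumsq S2 (N2 + m) - cumsq S2 N2))|
  <= gap splice N1 ^+ 2 + gap S2 N2 ^+ 2.
Proof.
case: m => [|m].
  by rewrite !addn0 cumsq_splice_left// subrr addr0 subrr normr0 addr_ge0 ?sqr_ge0.
suff -> : cumsq splice (N1 + m.+1) = cumsq S1 N1 + gap splice N1 ^+ 2 +
   (cumsq S2 (N2 + m.+1) - cumsq S2 N2.+1).
  rewrite cumsqS -/(gap S2 N2); apply: (@le_trans _ _ `|gap splice N1 ^+ 2 - gap S2 N2 ^+ 2|).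
    by rewrite le_eqVlt; apply/orP; left; apply/eqP; congr `|_|; ring.
  by rewrite (le_trans (ler_normB _ _))// !ger0_norm ?sqr_ge0.
elim: m => [|m IH].
  by rewrite !addn1 cumsqS cumsq_splice_left// subrr addr0.
rewrite addnS cumsqS IH [in RHS]addnS [in RHS]cumsqS -!addnS !splice_right; ring.
Qed.

Lemma events_upto_splice M : a <= M ->
  events_upto splice M =
  ([set S1 j | j in [set j : nat | (0 < j)%N]] `&` `]0, a]) `|`
  ([set S2 j | j in [set j : nat | (0 < j)%N]] `&` `]a, M]).
Proof.
move=> aM; have HF := splice_event_seq; apply/seteqP; split => y.
  move=> [[j /= j0 <-]]; rewrite in_itv/= => /andP[F0 FM].
  have [jN|Nj] := leqP j N1.
    left; split; first by exists j => //; rewrite splice_left.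
    rewrite /= in_itv/= F0 splice_left//; have /andP[h _] := S1a.
    by rewrite (le_trans _ h)// event_seq_le.
  have [m mE] : exists m, j = (N1 + m.+1)%N by exists (j - N1).-1; lia.
  right; split; first by exists (N2 + m.+1)%N; rewrite ?addnS// mE splice_right addnS.
  rewrite /= in_itv/= FM andbT mE splice_right; have /andP[_ h] := S2a.
  by rewrite (lt_le_trans h)// event_seq_le//; lia.
move=> [|] [[j /= j0 <-]]; rewrite in_itv/= => /andP[h1 h2].
  have jN : (j <= N1)%N by rewrite rank_ge.
  split; first by exists j => //; rewrite splice_left.
  by rewrite /= in_itv/= h1 (le_trans h2).
have jN : (N2 < j)%N by rewrite ltnNge rank_ge// -ltNge.
have [m mE] : exists m, j = (N2 + m.+1)%N by exists (j - N2).-1; lia.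
split; first by exists (N1 + m.+1)%N; rewrite ?addnS// -addnS splice_right mE.
by rewrite /= in_itv/= h2 (le_lt_trans a0).
Qed.
End splice.

Section single_process.
Variables (R : realType) (S : nat -> R) (mu e : R).
Hypotheses (HS : event_seq S) (mu0 : 0 < mu).
Hypotheses (Smu : S n / n%:R @[n --> \oo] --> mu)
  (Se : cumsq S n / n%:R @[n --> \oo] --> e).

Lemma rankS_cvg u :
  (rank S (n%:R * u)).+1%:R / n%:R @[n --> \oo] --> Num.max 0 u / mu.
Proof.
have -> : (fun n : nat => (rank S (n%:R * u)).+1%:R / n%:R : R) =
  (fun n : nat => (rank S (n%:R * u))%:R / n%:R + 1 / n%:R).
  by apply/funext => n; rewrite -natr1 mulrDl.
rewrite -[_ / mu]addr0; apply: cvgD; [exact: rank_cvg|exact: cvg_divn].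
Qed.

Lemma cumsq_rank_cvg u :
  cumsq S (rank S (n%:R * u)) / n%:R @[n --> \oo] --> e * (Num.max 0 u / mu).
Proof. by apply: cvg_along => //; exact: rank_cvg. Qed.

(** The squared gap is the increment of [cumsq] from r to r+1, and r/n and (r+1)/n have the same
    limit, so two equal limits are subtracted. *)
Lemma gap_rank_cvg u :
  gap S (rank S (n%:R * u)) ^+ 2 / n%:R @[n --> \oo] --> (0 : R).
Proof.
have -> : (fun n : nat => gap S (rank S (n%:R * u)) ^+ 2 / n%:R : R) =
  (fun n : nat => cumsq S (rank S (n%:R * u)).+1 / n%:R - cumsq S (rank S (n%:R * u)) / n%:R).
  by apply/funext => n; rewrite cumsqS -/(gap S _) mulrDl addrC addKr.
rewrite -(subrr (e * (Num.max 0 u / mu))); apply: cvgB; last exact: cumsq_rank_cvg.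
by apply: (cvg_along (k := fun n => (rank S (n%:R * u)).+1)) => //; exact: rankS_cvg.
Qed.
End single_process.

Section compound_process.
Variables (R : realType) (S1 S2 : nat -> R) (mu1 mu2 e1 e2 c : R).
Hypotheses (HS1 : event_seq S1) (HS2 : event_seq S2).
Hypotheses (mu1_gt0 : 0 < mu1) (mu2_gt0 : 0 < mu2) (c_gt0 : 0 < c).
Hypotheses (Smu1 : S1 n / n%:R @[n --> \oo] --> mu1)
  (Se1 : cumsq S1 n / n%:R @[n --> \oo] --> e1).
Hypotheses (Smu2 : S2 n / n%:R @[n --> \oo] --> mu2)
  (Se2 : cumsq S2 n / n%:R @[n --> \oo] --> e2).

(* Lengths of the parts of [0, u] governed by the first and by the second process. *)
Definition time1 (u : R) : R := Num.min (Num.max 0 u) c.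
Definition time2 (u : R) : R := Num.max 0 (u - c).

Lemma time_le u : u <= c -> time1 u = Num.max 0 u /\ time2 u = 0.
Proof.
move=> uc; split; first by rewrite /time1 min_l// ge_max uc (ltW c_gt0).
by rewrite /time2 max_l// subr_le0.
Qed.

Lemma time_ge u : c <= u -> time1 u = c /\ time2 u = u - c.
Proof.
move=> cu; split; first by rewrite /time1 min_r// le_max cu orbT.
by rewrite /time2 max_r// subr_ge0.
Qed.

Lemma time_add u : time1 u + time2 u = Num.max 0 u.
Proof.
have [uc|/ltW cu] := leP u c; first by have [-> ->] := time_le uc; rewrite addr0.
have [-> ->] := time_ge cu.
by rewrite addrC subrK max_r// (le_trans (ltW c_gt0)).
Qed.

Definition cseq (n : nat) : nat -> R := splice S1 S2 (n%:R * c).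
Definition crank (n : nat) (u : R) : nat := rank (cseq n) (n%:R * u).

Let nc0 n : 0 <= n%:R * c. Proof. by rewrite mulr_ge0// ltW. Qed.

Lemma cseq_event_seq n : event_seq (cseq n).
Proof. exact: splice_event_seq. Qed.

Let crank_le n u : u <= c -> crank n u = rank S1 (n%:R * u).
Proof. by move=> uc; apply: rank_splice_le => //; rewrite ler_wpM2l. Qed.

Let crank_ge n u : c <= u ->
  crank n u = (rank S1 (n%:R * c) + (rank S2 (n%:R * u) - rank S2 (n%:R * c)))%N.
Proof. by move=> cu; apply: rank_splice_ge => //; rewrite ler_wpM2l. Qed.

Let rank_le_c n u : u <= c -> (rank S1 (n%:R * u) <= rank S1 (n%:R * c))%N.
Proof. by move=> uc; apply: leq_rank => //; rewrite ler_wpM2l. Qed.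

Let rank_ge_c n u : c <= u -> (rank S2 (n%:R * c) <= rank S2 (n%:R * u))%N.
Proof. by move=> uc; apply: leq_rank => //; rewrite ler_wpM2l. Qed.

Let maxc : Num.max 0 c = c. Proof. by rewrite max_r// ltW. Qed.

Lemma crank_cvg u :
  (crank n u)%:R / n%:R @[n --> \oo] --> time1 u / mu1 + time2 u / mu2.
Proof.
have [uc|/ltW cu] := leP u c.
  have [-> ->] := time_le uc; rewrite mul0r addr0.
  have -> : (fun n => (crank n u)%:R / n%:R : R) = (fun n => (rank S1 (n%:R * u))%:R / n%:R).
    by apply/funext => n; rewrite crank_le.
  exact: rank_cvg.
have [-> ->] := time_ge cu.
have -> : (fun n => (crank n u)%:R / n%:R : R) = (fun n => (rank S1 (n%:R * c))%:R / n%:R +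
   ((rank S2 (n%:R * u))%:R / n%:R - (rank S2 (n%:R * c))%:R / n%:R)).
  by apply/funext => n; rewrite crank_ge// natrD natrB ?rank_ge_c// -mulrBl -mulrDl.
have h1 := rank_cvg (u := c) mu1_gt0 HS1 Smu1.
have h2 := rank_cvg (u := c) mu2_gt0 HS2 Smu2.
have h3 := rank_cvg (u := u) mu2_gt0 HS2 Smu2.
rewrite (max_r (le_trans (ltW c_gt0) cu)) in h3; rewrite maxc in h1 h2.
by rewrite mulrBl; apply: cvgD => //; exact: cvgB.
Qed.

Let cvg_sq3 (a b d : nat -> R) (x : nat -> R) :
  a n ^+ 2 / n%:R @[n --> \oo] --> (0 : R) ->
  b n ^+ 2 / n%:R @[n --> \oo] --> (0 : R) ->
  d n ^+ 2 / n%:R @[n --> \oo] --> (0 : R) ->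
  (forall n, 0 <= x n <= a n + (b n + d n)) ->
  x n ^+ 2 / n%:R @[n --> \oo] --> (0 : R).
Proof.
move=> ha hb hd hx.
have h : 3 * (a n ^+ 2 / n%:R + (b n ^+ 2 / n%:R + d n ^+ 2 / n%:R)) @[n --> \oo] --> (0 : R).
  have -> : 0 = 3 * (0 + (0 + 0)) :> R by rewrite !addr0 mulr0.
  by apply: cvgMl_tmp; apply: cvgD => //; apply: cvgD.
apply: (squeeze_cvgr _ (cvg_cst 0) h); apply: nearW => n.
rewrite divr_ge0 ?sqr_ge0//= -!mulrDl mulrA ler_wpM2r ?invr_ge0//.
have /andP[x0 xle] := hx n.
have : x n ^+ 2 <= (a n + (b n + d n)) ^+ 2 by rewrite !expr2 ler_pM.
move: (a n) (b n) (d n) => A B D.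
have := sqr_ge0 (A - B); have := sqr_ge0 (A - D); have := sqr_ge0 (B - D).
lra.
Qed.

(** A life time of the glued path is at most one life time of an original process plus the two that
    cover n c. *)
Lemma gap_crank_cvg u : gap (cseq n) (crank n u) ^+ 2 / n%:R @[n --> \oo] --> (0 : R).
Proof.
have g1 v := gap_rank_cvg HS1 mu1_gt0 Smu1 Se1 v.
have g2 v := gap_rank_cvg HS2 mu2_gt0 Smu2 Se2 v.
have [uc|/ltW cu] := leP u c.
  apply: (cvg_sq3 (g1 u) (g1 c) (g2 c)) => n; rewrite gap_ge0; last exact: cseq_event_seq.
  by rewrite crank_le//= gap_splice_left// rank_le_c.
apply: (cvg_sq3 (g2 u) (g1 c) (g2 c)) => n; rewrite gap_ge0; last exact: cseq_event_seq.
rewrite crank_ge//= (le_trans (gap_splice_right _ _ _ _))//.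
by rewrite subnKC ?rank_ge_c.
Qed.

Lemma cumsq_crank_cvg u : cumsq (cseq n) (crank n u) / n%:R @[n --> \oo] -->
  time1 u * (e1 / mu1) + time2 u * (e2 / mu2).
Proof.
have [uc|/ltW cu] := leP u c.
  have [-> ->] := time_le uc; rewrite mul0r addr0.
  have -> : (fun n => cumsq (cseq n) (crank n u) / n%:R : R) =
     (fun n => cumsq S1 (rank S1 (n%:R * u)) / n%:R).
    by apply/funext => n; rewrite crank_le// cumsq_splice_left// rank_le_c.
  by rewrite mulrCA; exact: cumsq_rank_cvg.
have [-> ->] := time_ge cu.
(* [H n] takes from each process the squares on its own side of n c; the junction changes it by at
   most two squared life times, which is o(n). *)
pose H n := cumsq S1 (rank S1 (n%:R * c)) +
  (cumsq S2 (rank S2 (n%:R * u)) - cumsq S2 (rank S2 (n%:R * c))).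
have Hcvg : H n / n%:R @[n --> \oo] --> c * (e1 / mu1) + (u - c) * (e2 / mu2).
  have -> : (fun n => H n / n%:R) = (fun n => cumsq S1 (rank S1 (n%:R * c)) / n%:R +
    (cumsq S2 (rank S2 (n%:R * u)) / n%:R - cumsq S2 (rank S2 (n%:R * c)) / n%:R)).
    by apply/funext => n; rewrite /H !mulrDl mulNr.
  have -> : c * (e1 / mu1) + (u - c) * (e2 / mu2) =
      e1 * (c / mu1) + (e2 * (u / mu2) - e2 * (c / mu2)).
    by field; rewrite !gt_eqF.
  apply: cvgD.
    by have := cumsq_rank_cvg (u := c) HS1 mu1_gt0 Smu1 Se1; rewrite maxc.
  have := cumsq_rank_cvg (u := u) HS2 mu2_gt0 Smu2 Se2.
  rewrite max_r; last by rewrite (le_trans (ltW c_gt0)).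
  have := cumsq_rank_cvg (u := c) HS2 mu2_gt0 Smu2 Se2; rewrite maxc => h1 h2.
  exact: cvgB.
have D0 : cumsq (cseq n) (crank n u) / n%:R - H n / n%:R @[n --> \oo] --> (0 : R).
  apply: norm_cvg0.
  have h : gap (cseq n) (crank n c) ^+ 2 / n%:R + gap S2 (rank S2 (n%:R * c)) ^+ 2 / n%:R
     @[n --> \oo] --> (0 : R).
    rewrite -[X in _ --> X](addr0 0); apply: cvgD; first exact: gap_crank_cvg.
    exact: (gap_rank_cvg HS2 mu2_gt0 Smu2 Se2).
  apply: (squeeze_cvgr _ (cvg_cst 0) h); apply: nearW => n.
  rewrite normr_ge0 -mulrBl normrM -mulrDl (@ger0_norm _ n%:R^-1)//= ler_wpM2r ?invr_ge0//.
  rewrite crank_ge// crank_le// /H.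
  have := cumsq_splice_right HS1 HS2 (nc0 n) (rank S2 (n%:R * u) - rank S2 (n%:R * c)).
  by rewrite subnKC ?rank_ge_c.
rewrite -[X in _ --> X]add0r.
apply: cvg_trans (cvgD D0 Hcvg); apply: near_eq_cvg; apply: nearW => n /=.
by rewrite subrK.
Qed.

Lemma cumsqS_crank_cvg u : cumsq (cseq n) (crank n u).+1 / n%:R @[n --> \oo] -->
  time1 u * (e1 / mu1) + time2 u * (e2 / mu2).
Proof.
rewrite -[X in _ --> X]addr0.
apply: cvg_trans (cvgD (@cumsq_crank_cvg u) (gap_crank_cvg u)).
by apply: near_eq_cvg; apply: nearW => n /=; rewrite cumsqS mulrDl.
Qed.

(** For n >= 1, a squared life time of at most e^2 n is at most (e n)^2. *)
Lemma gap1_crank_cvg u : gap (cseq n) (crank n u) / n%:R @[n --> \oo] --> (0 : R).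
Proof.
apply/cvgr0Pnorm_le => e e0.
have := gap_crank_cvg u; move/cvgr0Pnorm_le => /(_ (e ^+ 2)).
rewrite exprn_gt0// => /(_ isT) h; near=> n.
have n1 : 1 <= n%:R :> R by near: n; exists 1%N => // n /=; rewrite ler1n.
have n0 : 0 < n%:R :> R by lra.
have : `|gap (cseq n) (crank n u) ^+ 2 / n%:R| <= e ^+ 2 by near: n.
have g0 : 0 <= gap (cseq n) (crank n u) by apply: gap_ge0; exact: cseq_event_seq.
rewrite !ger0_norm ?divr_ge0 ?sqr_ge0//.
rewrite !ler_pdivrMr// => h1.
rewrite -(@ler_pXn2r _ 2)// ?nnegrE ?mulr_ge0 ?(ltW e0)//.
rewrite (le_trans h1)// exprMn ler_pM2l ?exprn_gt0//.
by rewrite expr2 ler_peMl// ltW.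
Unshelve. all: by end_near. Qed.

(** For u >= 0 the last event up to n u misses n u by less than one life time, which is o(n). *)
Lemma cseq_crank_cvg u : cseq n (crank n u) / n%:R @[n --> \oo] --> Num.max 0 u.
Proof.
have [u0|u0] := ltP u 0.
  apply: cvg_near_cst; exists 1%N => // n /= n0.
  rewrite /crank rank_lt0//; first by have [-> _ _] := cseq_event_seq n; rewrite mul0r.
    exact: cseq_event_seq.
  by rewrite pmulr_rlt0// ltr0n.
have h : u - gap (cseq n) (crank n u) / n%:R @[n --> \oo] --> u.
  by rewrite -[X in _ --> X]subr0; apply: cvgB; [exact: cvg_cst|exact: gap1_crank_cvg].
apply: (squeeze_cvgr _ h (cvg_cst u)); exists 1%N => // n /= n1.
have n0 : 0 < n%:R :> R by rewrite ltr0n.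
have nu0 : 0 <= n%:R * u by rewrite mulr_ge0.
have /andP[h1 h2] := rankP (cseq_event_seq n) nu0.
rewrite ler_pdivrMr// [u * _]mulrC h1 andbT lerBlDr -mulrDl ler_pdivlMr// [u * _]mulrC.
by rewrite /gap addrC subrK ltW.
Qed.

Lemma cseqS_crank_cvg u : cseq n (crank n u).+1 / n%:R @[n --> \oo] --> Num.max 0 u.
Proof.
rewrite -[X in _ --> X]addr0.
apply: cvg_trans (cvgD (@cseq_crank_cvg u) (gap1_crank_cvg u)).
by apply: near_eq_cvg; apply: nearW => n /=; rewrite -mulrDl /gap addrC subrK.
Qed.
End compound_process.

(** * Uniform convergence *)

Section joint_convergence.
Variable R : realType.

(* Monotonicity in s replaces equicontinuity: G n s lies between G n (t - d/2) and
   G n (t + d/2). *)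
Lemma monotone_joint_cvg (G : nat -> R -> R) (g : R -> R) (t : R) :
  (forall n, {homo G n : u v / u <= v}) ->
  (forall u, G n u @[n --> \oo] --> g u) -> g x @[x --> t] --> g t ->
  G p.2 p.1 @[p --> filter_prod (nbhs t) \oo] --> g t.
Proof.
move=> ndG Gg gt; apply/cvgrPdist_le => e e0.
have e20 : 0 < e / 2 by rewrite divr_gt0.
have /nbhs_ballP[d /= d0 hd] : \forall x \near t, `|g t - g x| <= e / 2.
  by move/cvgrPdist_le : gt; exact.
have d20 : 0 < d / 2 by rewrite divr_gt0.
pose lo := t - d / 2; pose hi := t + d / 2.
have glo : `|g t - g lo| <= e / 2.
  by apply: hd; rewrite /ball /= /lo opprB addrC subrK gtr0_norm// ltr_pdivrMr// mulr2n; lra.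
have ghi : `|g t - g hi| <= e / 2.
  apply: hd; rewrite /ball /= /hi opprD addrA subrr sub0r normrN gtr0_norm//.
  by rewrite ltr_pdivrMr//; lra.
have Nlo : \forall n \near \oo, `|g lo - G n lo| <= e / 2.
  by move/cvgrPdist_le : (Gg lo); exact.
have Nhi : \forall n \near \oo, `|g hi - G n hi| <= e / 2.
  by move/cvgrPdist_le : (Gg hi); exact.
exists (ball t (d / 2), [set n | `|g lo - G n lo| <= e / 2 /\ `|g hi - G n hi| <= e / 2]).
  split; first exact: nbhsx_ballx.
  by apply: filterS2 Nlo Nhi => n.
move=> [s n] [/=]; rewrite /ball /= => st [hlo hhi].
have h1 : G n lo <= G n s.
  by apply: ndG; rewrite /lo lerBlDr -lerBlDl (le_trans (ler_norm _))// ltW.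
have h2 : G n s <= G n hi.
  by apply: ndG; rewrite /hi -lerBlDl (le_trans (ler_norm _))// distrC ltW.
move: glo ghi hlo hhi; rewrite !ler_distl => /andP[? ?] /andP[? ?] /andP[? ?] /andP[? ?].
by apply/andP; split; lra.
Qed.

Variables (F : nat -> nat -> R) (K : nat -> R -> nat) (k f q : R -> R).
Hypotheses (HF : forall n, event_seq (F n))
  (ndK : forall n u v, u <= v -> (K n u <= K n v)%N).
Hypotheses (Kk : forall u, (K n u)%:R / n%:R @[n --> \oo] --> k u)
  (Ff : forall u, F n (K n u) / n%:R @[n --> \oo] --> f u)
  (FSf : forall u, F n (K n u).+1 / n%:R @[n --> \oo] --> f u)
  (Qq : forall u, cumsq (F n) (K n u) / n%:R @[n --> \oo] --> q u)
  (QSq : forall u, cumsq (F n) (K n u).+1 / n%:R @[n --> \oo] --> q u).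
Hypotheses (ck : continuous k) (cf : continuous f) (cq : continuous q).
Variables (a b t : R).
Hypothesis kab : k (t + a) < k (t + b).

Local Notation FP := (filter_prod (nbhs t) \oo).

(** The map [m] will be the identity or the successor, as the estimators read the path at the count
    of the right end and just after the count of the left end. *)
Let shift_cvg (H : nat -> nat -> R) (g : R -> R) (m : nat -> nat) x :
  (forall n, {homo H n : i j / (i <= j)%N >-> i <= j}) ->
  {homo m : i j / (i <= j)%N >-> (i <= j)%N} ->
  (forall u, H n (m (K n u)) / n%:R @[n --> \oo] --> g u) -> continuous g ->
  H p.2 (m (K p.2 (p.1 + x))) / p.2%:R @[p --> FP] --> g (t + x).
Proof.
move=> ndH ndm Hg cg.
apply: (@monotone_joint_cvg (fun n s => H n (m (K n (s + x))) / n%:R) (fun s => g (s + x))).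
- by move=> n u v uv; rewrite ler_wpM2r ?invr_ge0//; apply/ndH/ndm/ndK; rewrite lerD2r.
- by move=> u; exact: Hg.
- apply: (@continuous_comp _ _ _ (fun s => s + x) g); last exact: cg.
  by apply: cvgD; [exact: cvg_id|exact: cvg_cst].
Qed.

Let Fnd n : {homo F n : i j / (i <= j)%N >-> i <= j}.
Proof. by move=> i j ij; rewrite event_seq_le. Qed.

Let Qnd n : {homo cumsq (F n) : i j / (i <= j)%N >-> i <= j}.
Proof.
move=> i j /subnK <-; elim: (j - i)%N => [//|m IH].
by rewrite addSn cumsqS (le_trans IH)// lerDl sqr_ge0.
Qed.

Let natnd : {homo (fun i => i%:R : R) : i j / (i <= j)%N >-> i <= j}.
Proof. by move=> i j; rewrite ler_nat. Qed.

Let idnd : {homo (fun i : nat => i) : i j / (i <= j)%N >-> (i <= j)%N}. Proof. by []. Qed.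
Let Snd : {homo S : i j / (i <= j)%N >-> (i <= j)%N}. Proof. by []. Qed.

Let Kj x : (K p.2 (p.1 + x))%:R / p.2%:R @[p --> FP] --> k (t + x).
Proof. by apply: (@shift_cvg (fun _ i => i%:R) k (fun i => i) x) => // n; exact: natnd. Qed.

Let invj (C : R) : C / p.2%:R @[p --> FP] --> (0 : R).
Proof.
have h : (p.2 : nat) @[p --> FP] --> \oo by exact: cvg_snd.
exact: (cvg_comp _ _ h (cvg_divn C)).
Qed.

Let npos : \forall p \near FP, (0 < p.2%:R :> R).
Proof.
have h : (p.2 : nat) @[p --> FP] --> \oo by exact: cvg_snd.
by apply: (h [set n : nat | 0 < n%:R :> R]); exists 1%N => // n /=; rewrite ltr0n.
Qed.

(** The limiting count over the window is positive by [kab], so near t and for large n the default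
    branches of both estimators are out of reach. *)
Let many : \forall p \near FP, (2 < K p.2 (p.1 + b) - K p.2 (p.1 + a))%N.
Proof.
have h : (K p.2 (p.1 + b))%:R / p.2%:R - (K p.2 (p.1 + a))%:R / p.2%:R - 2 / p.2%:R
  @[p --> FP] --> k (t + b) - k (t + a).
  by rewrite -[X in _ --> X]subr0; apply: cvgB => //; apply: cvgB.
have pos : 0 < k (t + b) - k (t + a) by rewrite subr_gt0.
have h0 : \forall p \near FP, 0 < (K p.2 (p.1 + b))%:R / p.2%:R -
    (K p.2 (p.1 + a))%:R / p.2%:R - 2 / p.2%:R :> R.
  move/cvgrPdist_lt : h => /(_ _ pos) ; apply: filterS => p.
  by rewrite ltr_distlC subrr => /andP[].
apply: filterS2 npos h0 => p p0.
rewrite -!mulrBl pmulr_lgt0 ?invr_gt0// subr_gt0 ltrBrDl -natrD ltr_nat; lia.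
Qed.

Lemma idx_mean_cvg : idx_mean (F p.2) (K p.2 (p.1 + a)) (K p.2 (p.1 + b)) @[p --> FP] -->
  (f (t + b) - f (t + a)) / (k (t + b) - k (t + a)).
Proof.
have h : (F p.2 (K p.2 (p.1 + b)) / p.2%:R - F p.2 (K p.2 (p.1 + a)).+1 / p.2%:R) /
  ((K p.2 (p.1 + b))%:R / p.2%:R - (K p.2 (p.1 + a))%:R / p.2%:R - 1 / p.2%:R)
  @[p --> FP] --> (f (t + b) - f (t + a)) / (k (t + b) - k (t + a) - 0).
  apply: cvgM.
    apply: cvgB; first exact: (@shift_cvg F f (fun i => i) b).
    exact: (@shift_cvg F f S a).
  apply: cvgV; first by rewrite subr0 gt_eqF// subr_gt0.
  by apply: cvgB => //; apply: cvgB.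
rewrite subr0 in h; apply: cvg_trans h; apply: near_eq_cvg.
apply: filterS2 npos many => p p0 hp /=.
rewrite /idx_mean ifT; last exact: ltnW.
by rewrite -!mulrBl invf_div mulrA divfK ?gt_eqF.
Qed.

Lemma idx_var_cvg : idx_var (F p.2) (K p.2 (p.1 + a)) (K p.2 (p.1 + b)) @[p --> FP] -->
  (q (t + b) - q (t + a)) / (k (t + b) - k (t + a)) -
  ((f (t + b) - f (t + a)) / (k (t + b) - k (t + a))) ^+ 2.
Proof.
have k0 : k (t + b) - k (t + a) != 0 by rewrite gt_eqF// subr_gt0.
pose D (p : R * nat) : R := (K p.2 (p.1 + b))%:R / p.2%:R - (K p.2 (p.1 + a))%:R / p.2%:R.
have hD C : D p - C / p.2%:R @[p --> FP] --> k (t + b) - k (t + a).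
  by rewrite -[X in _ --> X]subr0; apply: cvgB => //; apply: cvgB.
have h : (cumsq (F p.2) (K p.2 (p.1 + b)) / p.2%:R -
          cumsq (F p.2) (K p.2 (p.1 + a)).+1 / p.2%:R -
    idx_mean (F p.2) (K p.2 (p.1 + a)) (K p.2 (p.1 + b)) ^+ 2 * (D p - 1 / p.2%:R)) /
    (D p - 2 / p.2%:R) @[p --> FP] -->
  (q (t + b) - q (t + a) - ((f (t + b) - f (t + a)) / (k (t + b) - k (t + a))) ^+ 2 *
     (k (t + b) - k (t + a))) / (k (t + b) - k (t + a)).
  apply: cvgM; last exact: cvgV.
  apply: cvgB.
    apply: cvgB; first exact: (@shift_cvg (fun n => cumsq (F n)) q (fun i => i) b).
    exact: (@shift_cvg (fun n => cumsq (F n)) q S a).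
  by apply: cvgM => //; apply: cvgM; exact: idx_mean_cvg.
rewrite [X in _ --> X]mulrBl mulfK// in h.
apply: cvg_trans h; apply: near_eq_cvg.
apply: filterS2 npos many => p p0 hp /=.
rewrite /idx_var ifT// /D -!mulrBl mulrA -!mulrBl.
by rewrite invf_div mulrA divfK ?gt_eqF.
Qed.
End joint_convergence.

(** * Supremum norm and one-sided limits *)

Section path_regularity.
Variable R : realType.
Implicit Types (a b t : R) (f g : R -> R).

Lemma cvg_supnorm_joint a b (f : nat -> R -> R) g : a <= b ->
  (forall t, t \in `[a, b] -> f p.2 p.1 @[p --> filter_prod (nbhs t) \oo] --> g t) ->
  (forall t, t \in `[a, b] -> {for t, continuous g}) ->
  cvg_supnorm a b f g.
Proof.
move=> ab fg cg.
have unif e : 0 < e -> \forall n \near \oo, forall t, t \in `[a, b] -> `|f n t - g t| <= e.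
  move=> e0; have /compact_near_coveringP cov := @segment_compact R a b.
  have := cov nat \oo (fun n t => `|f n t - g t| <= e) _; apply => t tab.
  (* Continuity of [g] turns closeness to the fixed value [g t] into closeness to [g] at the moving
     point. *)
  have h : f p.2 p.1 - g p.1 @[p --> filter_prod (nbhs t) \oo] --> (0 : R).
    rewrite -(subrr (g t)); apply: cvgB; first exact: fg.
    have h1 : p.1 @[p --> filter_prod (nbhs t) (\oo : set_system nat)] --> t by exact: cvg_fst.
    exact: (cvg_comp _ _ h1 (cg _ tab)).
  by move/cvgr0Pnorm_le : h => /(_ e e0).
(* Here [a <= b] matters: over an empty interval the extended supremum would be -oo. *)
have S0 n : (0 <= ereal_sup [set (`|f n t - g t|)%:E | t in `[a, b]])%E.
  apply: (@le_trans _ _ (`|f n a - g a|)%:E); first by rewrite lee_fin.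
  by apply: ereal_sup_ubound; exists a => //=; rewrite in_itv/= lexx.
have Se e : 0 < e ->
    \forall n \near \oo, (ereal_sup [set (`|f n t - g t|)%:E | t in `[a, b]] <= e%:E)%E.
  move=> /unif; apply: filterS => n h; apply: ge_ereal_sup => _ [t tab <-].
  by rewrite lee_fin h.
apply/fine_cvgP; split.
  apply: filterS (Se 1 ltr01) => n h; rewrite ge0_fin_numE//.
  by apply: le_lt_trans h _; rewrite ltry.
apply/cvgr0Pnorm_le => e e0; apply: filterS (Se e e0) => n h /=.
rewrite ger0_norm ?fine_ge0// -lee_fin fineK// ge0_fin_numE//.
by apply: le_lt_trans h _; rewrite ltry.
Qed.

Lemma cadlag_eq_continuous a b f g :
  (forall t, t \in `[a, b] -> f t = g t) ->
  (forall t, t \in `[a, b] -> {for t, continuous g}) -> cadlag a b f.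
Proof.
move=> fg cg; split => t; rewrite in_itv/= => /andP[h1 h2].
  have tab : t \in `[a, b] by rewrite in_itv/= h1 ltW.
  rewrite fg//; apply: cvg_trans (cvg_at_right_filter (cg _ tab)).
  apply: near_eq_cvg; near=> x; apply/esym/fg; rewrite in_itv/=; apply/andP; split.
    by apply: le_trans h1 _; apply: ltW; near: x; exact: nbhs_right_gt.
  by near: x; exact: nbhs_right_ltW.
have tab : t \in `[a, b] by rewrite in_itv/= h2 ltW.
apply/cvg_ex; exists (g t); apply: cvg_trans (cvg_at_left_filter (cg _ tab)).
apply: near_eq_cvg; near=> x; apply/esym/fg; rewrite in_itv/=; apply/andP; split.
  by apply: ltW; near: x; exact: nbhs_left_gt.
by apply: le_trans h2; apply: ltW; near: x; exact: nbhs_left_lt.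
Unshelve. all: by end_near. Qed.

(** Next to any point, on either side, [r] is constant, so the one-sided limits come from the
    continuous factor. *)
Lemma cadlag_mul_step a b f g (r : R -> R) :
  (forall t, t \in `[a, b] -> f t = g t * r t) -> continuous g ->
  (forall t, \forall x \near t^'+, r x = r t) ->
  (forall t, exists y, \forall x \near t^'-, r x = y) -> cadlag a b f.
Proof.
move=> fgr cg rr rl; split => t; rewrite in_itv/= => /andP[h1 h2].
  rewrite fgr ?in_itv/= ?h1 ?ltW//.
  have hg : g x * r t @[x --> t^'+] --> g t * r t.
    by apply: cvgM; [exact: cvg_at_right_filter (cg t)|exact: cvg_cst].
  apply: cvg_trans hg; apply: near_eq_cvg; near=> x.
  have -> : r t = r x by apply/esym; near: x; exact: rr.
  apply/esym/fgr; rewrite in_itv/=; apply/andP; split.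
    by apply: le_trans h1 _; apply: ltW; near: x; exact: nbhs_right_gt.
  by near: x; exact: nbhs_right_ltW.
have [y hy] := rl t.
apply/cvg_ex; exists (g t * y).
have hg : g x * y @[x --> t^'-] --> g t * y.
  by apply: cvgM; [exact: cvg_at_left_filter (cg t)|exact: cvg_cst].
apply: cvg_trans hg; apply: near_eq_cvg; near=> x.
have -> : y = r x by apply/esym; near: x; exact: hy.
apply/esym/fgr; rewrite in_itv/=; apply/andP; split.
  by apply: ltW; near: x; exact: nbhs_left_gt.
by apply: le_trans h2; apply: ltW; near: x; exact: nbhs_left_lt.
Unshelve. all: by end_near. Qed.

Lemma rank_scaled_right (F : nat -> R) (n : nat) x t : event_seq F -> (0 < n)%N ->
  \forall s \near t^'+, rank F (n%:R * (s + x)) = rank F (n%:R * (t + x)).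
Proof.
move=> HF n0; have nr0 : 0 < n%:R :> R by rewrite ltr0n.
have [e e0 h] := rank_right HF (n%:R * (t + x)).
near=> s; apply: h.
have ts : t < s by near: s; exact: nbhs_right_gt.
have se : s < t + e / n%:R by near: s; apply: nbhs_right_lt; rewrite ltrDl divr_gt0.
rewrite ler_pM2l// lerD2r (ltW ts)/=.
rewrite -ltrBlDl -mulrBr mulrC -ltr_pdivlMr//; lra.
Unshelve. all: by end_near. Qed.

Lemma rank_scaled_left (F : nat -> R) (n : nat) x t : event_seq F -> (0 < n)%N ->
  exists j, \forall s \near t^'-, rank F (n%:R * (s + x)) = j.
Proof.
move=> HF n0; have nr0 : 0 < n%:R :> R by rewrite ltr0n.
have [e e0 [j h]] := rank_left HF (n%:R * (t + x)).
exists j; near=> s; apply: h.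
have ts : s < t by near: s; exact: nbhs_left_lt.
have se : t - e / n%:R < s by near: s; apply: nbhs_left_gt; rewrite ltrBlDr ltrDl divr_gt0.
rewrite ltr_pM2l// ltrD2r ts andbT.
rewrite ltrBlDr -ltrBlDl -mulrBr mulrC -ltr_pdivlMr//; lra.
Unshelve. all: by end_near. Qed.
End path_regularity.

(** * Identification of the limits with the mixture formulas *)

Section window_limits.
Variables (R : realType) (c mu1 mu2 sigma1 sigma2 : R).
Hypotheses (c_gt0 : 0 < c) (mu1_gt0 : 0 < mu1) (mu2_gt0 : 0 < mu2)
  (sigma1_gt0 : 0 < sigma1) (sigma2_gt0 : 0 < sigma2).

Let e1 := mu1 ^+ 2 + sigma1 ^+ 2.
Let e2 := mu2 ^+ 2 + sigma2 ^+ 2.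

Definition rank_lim (u : R) := time1 c u / mu1 + time2 c u / mu2.
Definition cumsq_lim (u : R) := time1 c u * (e1 / mu1) + time2 c u * (e2 / mu2).

Definition mean_lim (u v : R) : R :=
  (Num.max 0 v - Num.max 0 u) / (rank_lim v - rank_lim u).
Definition var_lim (u v : R) : R :=
  (cumsq_lim v - cumsq_lim u) / (rank_lim v - rank_lim u) - mean_lim u v ^+ 2.

Definition dur1 (u v : R) := time1 c v - time1 c u.
Definition dur2 (u v : R) := time2 c v - time2 c u.

Lemma dur_ge0 u v : u <= v -> 0 <= dur1 u v /\ 0 <= dur2 u v.
Proof.
move=> uv; rewrite /dur1 /dur2 !subr_ge0 /time1 /time2; split.
  by rewrite le_min2// le_max2.
by rewrite le_max2// lerD2r.
Qed.

Lemma dur_add u v : 0 <= u -> u <= v -> dur1 u v + dur2 u v = v - u.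
Proof.
move=> u0 uv; have := time_add c_gt0 u; have := time_add c_gt0 v.
rewrite !max_r ?(le_trans u0)// /dur1 /dur2; lra.
Qed.

Lemma durE u v : 0 <= u -> u <= v ->
  (v <= c -> dur1 u v = v - u /\ dur2 u v = 0) /\
  (u <= c <= v -> dur1 u v = c - u /\ dur2 u v = v - c) /\
  (c <= u -> dur1 u v = 0 /\ dur2 u v = v - u).
Proof.
move=> u0 uv; have v0 := le_trans u0 uv; rewrite /dur1 /dur2; split=> [vc|]; last split.
- have [-> ->] := time_le c_gt0 vc; have [-> ->] := time_le c_gt0 (le_trans uv vc).
  by rewrite !max_r// subrr.
- move=> /andP[uc cv]; have [-> ->] := time_ge cv; have [-> ->] := time_le c_gt0 uc.
  by rewrite max_r// subr0.
- move=> cu; have [-> ->] := time_ge cu; have [-> ->] := time_ge (le_trans cu uv).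
  by rewrite subrr; split=> //; ring.
Qed.

Lemma rank_lim_lt u v : 0 <= u -> u < v -> rank_lim u < rank_lim v.
Proof.
move=> u0 uv; have [h1 h2] := dur_ge0 (ltW uv); have h3 := dur_add u0 (ltW uv).
rewrite -subr_gt0; have -> : rank_lim v - rank_lim u = dur1 u v / mu1 + dur2 u v / mu2.
  by rewrite /rank_lim /dur1 /dur2; field; rewrite !gt_eqF.
move: h1; rewrite le_eqVlt => /predU1P[h1|h1].
  by rewrite -h1 mul0r add0r divr_gt0//; lra.
by rewrite ltr_wpDr ?divr_gt0// divr_ge0// ltW.
Qed.

Lemma mean_limE u v : 0 <= u -> u < v ->
  mean_lim u v = mix_mean (v - u) mu1 mu2 (dur1 u v) (dur2 u v).
Proof.
move=> u0 uv; have k0 := rank_lim_lt u0 uv; rewrite /mean_lim /mix_mean.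
rewrite !max_r ?(le_trans u0) ?(ltW uv)//.
have E : dur1 u v * mu2 + dur2 u v * mu1 = (rank_lim v - rank_lim u) * (mu1 * mu2).
  by rewrite /rank_lim /dur1 /dur2; field; rewrite !gt_eqF.
rewrite E; field; by rewrite !gt_eqF// subr_gt0.
Qed.

(** The pooled life times form a mixture with weights p = A mu2 / D and q = B mu1 / D, where A, B
    are the durations and D = A mu2 + B mu1. Its variance is p s1^2 + q s2^2 + p q (mu1 - mu2)^2,
    and p s1^2 + q s2^2 = (p s1 + q s2)^2 + p q (s1 - s2)^2 gives the shape of [mix_var]. *)
Lemma var_limE u v : 0 <= u -> u < v ->
  var_lim u v = mix_var mu1 mu2 sigma1 sigma2 (dur1 u v) (dur2 u v).
Proof.
move=> u0 uv; have k0 := rank_lim_lt u0 uv; rewrite /var_lim mean_limE//.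
have E : rank_lim v - rank_lim u = (dur1 u v * mu2 + dur2 u v * mu1) / (mu1 * mu2).
  by rewrite /rank_lim /dur1 /dur2; field; rewrite !gt_eqF.
have Q : cumsq_lim v - cumsq_lim u = dur1 u v * (e1 / mu1) + dur2 u v * (e2 / mu2).
  by rewrite /cumsq_lim /dur1 /dur2; ring.
have D0 : 0 < dur1 u v * mu2 + dur2 u v * mu1.
  by move: k0; rewrite -subr_gt0 E pmulr_lgt0// invr_gt0 mulr_gt0.
rewrite Q E /mix_mean /mix_var -(dur_add u0 (ltW uv)) /e1 /e2.
move: D0; move: (dur1 u v) (dur2 u v) => A B D0.
field; by rewrite !gt_eqF.
Qed.

Lemma mean_lim_gt0 u v : 0 <= u -> u < v -> 0 < mean_lim u v.
Proof.
move=> u0 uv; rewrite /mean_lim !max_r ?(le_trans u0) ?(ltW uv)//.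
by rewrite divr_gt0// subr_gt0// rank_lim_lt.
Qed.

(** The squared term in the numerator of [mix_var] is positive, since the durations are nonnegative
    with positive sum. *)
Lemma var_lim_gt0 u v : 0 <= u -> u < v -> 0 < var_lim u v.
Proof.
move=> u0 uv; rewrite var_limE//.
have [h1 h2] := dur_ge0 (ltW uv); have h3 := dur_add u0 (ltW uv).
move: h1 h2 h3; move: (dur1 u v) (dur2 u v) => A B A0 B0 AB.
have pos x y : 0 < x -> 0 < y -> 0 < A * x + B * y.
  move=> x0 y0; move: A0; rewrite le_eqVlt => /predU1P[A0|A0].
    by rewrite -A0 mul0r add0r mulr_gt0//; lra.
  by rewrite ltr_wpDr ?mulr_gt0// mulr_ge0// ltW.
rewrite /mix_var divr_gt0 ?exprn_gt0 ?pos//.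
rewrite ltr_wpDl ?exprn_gt0//.
  by rewrite !mulr_ge0 ?addr_ge0 ?sqr_ge0 ?(ltW mu1_gt0) ?(ltW mu2_gt0).
by rewrite addrC -!mulrA pos ?mulr_gt0.
Qed.

Lemma time1_continuous : continuous (time1 c).
Proof.
move=> x; apply: (@continuous_min R R (fun u => Num.max 0 u) (fun=> c)).
  by apply: (@continuous_max R R (fun=> 0) (fun u => u)); [exact: cvg_cst|exact: cvg_id].
exact: cvg_cst.
Qed.

Lemma time2_continuous : continuous (time2 c).
Proof.
move=> x; apply: (@continuous_max R R (fun=> 0) (fun u => u - c)); first exact: cvg_cst.
by apply: cvgB; [exact: cvg_id|exact: cvg_cst].
Qed.

Lemma max0_continuous : continuous (fun u : R => Num.max 0 u).
Proof.
move=> x; apply: (@continuous_max R R (fun=> 0) (fun u => u)); first exact: cvg_cst.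
exact: cvg_id.
Qed.

Lemma rank_lim_continuous : continuous rank_lim.
Proof.
move=> x; apply: cvgD; apply: cvgM; try exact: cvg_cst.
  exact: time1_continuous.
exact: time2_continuous.
Qed.

Lemma cumsq_lim_continuous : continuous cumsq_lim.
Proof.
move=> x; apply: cvgD; apply: cvgM; try exact: cvg_cst.
  exact: time1_continuous.
exact: time2_continuous.
Qed.

Let shift_continuous (g : R -> R) a t : continuous g -> g (s + a) @[s --> t] --> g (t + a).
Proof.
move=> cg; apply: (@continuous_comp _ _ _ (fun s => s + a) g); last exact: cg.
by apply: cvgD; [exact: cvg_id|exact: cvg_cst].
Qed.

Lemma mean_lim_continuous a b t : 0 <= t + a -> a < b ->
  mean_lim (s + a) (s + b) @[s --> t] --> mean_lim (t + a) (t + b).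
Proof.
move=> ta ab; apply: cvgM.
  by apply: cvgB; apply: (shift_continuous (g := fun u => Num.max 0 u)); exact: max0_continuous.
apply: cvgV; first by rewrite gt_eqF// subr_gt0 rank_lim_lt// ltrD2l.
by apply: cvgB; apply: shift_continuous; exact: rank_lim_continuous.
Qed.

Lemma var_lim_continuous a b t : 0 <= t + a -> a < b ->
  var_lim (s + a) (s + b) @[s --> t] --> var_lim (t + a) (t + b).
Proof.
move=> ta ab; apply: cvgB; last by apply: cvgM; exact: mean_lim_continuous.
apply: cvgM.
  by apply: cvgB; apply: shift_continuous; exact: cumsq_lim_continuous.
apply: cvgV; first by rewrite gt_eqF// subr_gt0 rank_lim_lt// ltrD2l.
by apply: cvgB; apply: shift_continuous; exact: rank_lim_continuous.
Qed.
End window_limits.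

(** * The scaling ratio on a single path *)

Section compound_paths.
Variables (R : realType) (T h c mu1 mu2 sigma1 sigma2 : R).
Hypotheses (h_gt0 : 0 < h) (h_le : h <= T / 2) (c_gt0 : 0 < c) (c_lt : c < T)
  (mu1_gt0 : 0 < mu1) (mu2_gt0 : 0 < mu2)
  (sigma1_gt0 : 0 < sigma1) (sigma2_gt0 : 0 < sigma2).

Let mean := mean_lim c mu1 mu2.
Let var := var_lim c mu1 mu2 sigma1 sigma2.

(** The three cases of the true scaling in one formula without the factor n: each process
    contributes sigma^2/mu^3 times its share of the window from t-h to t+h. Continuity in t is then
    immediate. *)
Definition true_sq (t : R) : R :=
  dur1 c (t - h) (t + h) * (sigma1 ^+ 2 / mu1 ^+ 3) +
  dur2 c (t - h) (t + h) * (sigma2 ^+ 2 / mu2 ^+ 3).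

(** Writing [t + 0] gives both windows the shape [t + a], [t + b] of the joint limits; the factor n
    h is left out. *)
Definition est_sq_lim (t : R) : R :=
  var (t + 0) (t + h) / mean (t + 0) (t + h) ^+ 3 +
  var (t - h) (t + 0) / mean (t - h) (t + 0) ^+ 3.

Lemma s_trueE n t : h <= t ->
  s_true h c mu1 mu2 sigma1 sigma2 n t = Num.sqrt (n%:R * true_sq t).
Proof.
move=> ht; have th0 : 0 <= t - h by rewrite subr_ge0.
have h0 := h_gt0; have thh : t - h <= t + h by lra.
have [D1 [D2 D3]] := durE c_gt0 th0 thh; congr Num.sqrt; rewrite /true_sq.
case: ifPn => [tc|]; first by have [-> ->] := D1 (ltac:(lra)); ring.
rewrite -leNgt => tc; case: ifPn => [|].
  rewrite ler_norml => /andP[? ?]; have [-> ->] := D2 (ltac:(apply/andP; split; lra)).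
  by ring.
rewrite -ltNge ltr_normr => /orP[?|?]; last by exfalso; lra.
by have [-> ->] := D3 (ltac:(lra)); ring.
Qed.

(** A window on one side of the change point is a degenerate mixture, which reconciles the cases of
    the limits with a single formula. *)
Let mix_left : mix_mean h mu1 mu2 h 0 = mu1 /\
  mix_var mu1 mu2 sigma1 sigma2 h 0 = sigma1 ^+ 2.
Proof. by rewrite /mix_mean /mix_var; split; field; rewrite ?gt_eqF. Qed.

Let mix_right : mix_mean h mu1 mu2 0 h = mu2 /\
  mix_var mu1 mu2 sigma1 sigma2 0 h = sigma2 ^+ 2.
Proof. by rewrite /mix_mean /mix_var; split; field; rewrite ?gt_eqF. Qed.

Lemma window_riE t : 0 <= t -> mu_ri h c mu1 mu2 t = mean (t + 0) (t + h) /\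
  sigma2_ri h c mu1 mu2 sigma1 sigma2 t = var (t + 0) (t + h).
Proof.
have h0 := h_gt0; rewrite addr0 => t0; have th : t < t + h by rewrite ltrDl.
have E : t + h - t = h by ring.
rewrite /mean /var mean_limE// var_limE// E.
have [D1 [D2 D3]] := durE c_gt0 t0 (ltW th).
rewrite E in D1 D3.
rewrite /mu_ri /sigma2_ri; case: ifPn => [tc|].
  by have [-> ->] := D1 (ltac:(lra)); have [-> ->] := mix_left.
rewrite -ltNge => tc; case: ifPn => [tc'|].
  by have [-> ->] := D2 (ltac:(apply/andP; split; lra)).
rewrite -ltNge => tc'.
by have [-> ->] := D3 (ltW tc'); have [-> ->] := mix_right.
Qed.

Lemma window_leE t : h <= t -> mu_le h c mu1 mu2 t = mean (t - h) (t + 0) /\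
  sigma2_le h c mu1 mu2 sigma1 sigma2 t = var (t - h) (t + 0).
Proof.
have h0 := h_gt0; rewrite addr0 => ht; have th0 : 0 <= t - h by rewrite subr_ge0.
have th : t - h < t by rewrite ltrBlDr ltrDl.
have E : t - (t - h) = h by ring.
rewrite /mean /var mean_limE// var_limE// E.
have [D1 [D2 D3]] := durE c_gt0 th0 (ltW th).
rewrite E in D1 D3.
rewrite /mu_le /sigma2_le; case: ifPn => [tc|].
  by have [-> ->] := D1 tc; have [-> ->] := mix_left.
rewrite -ltNge => tc; case: ifPn => [tc'|].
  have [-> ->] := D2 (ltac:(apply/andP; split; lra)).
  by rewrite opprB addrA addrAC.
rewrite -ltNge => tc'.
by have [-> ->] := D3 (ltac:(lra)); have [-> ->] := mix_right.
Qed.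

Lemma s_tildeE n t : h <= t ->
  s_tilde h c mu1 mu2 sigma1 sigma2 n t = Num.sqrt (est_sq_lim t * (n%:R * h)).
Proof.
move=> ht; have [r1 r2] := window_riE (le_trans (ltW h_gt0) ht).
by have [l1 l2] := window_leE ht; rewrite /s_tilde r1 r2 l1 l2.
Qed.

Lemma est_sq_lim_gt0 t : h <= t -> 0 < est_sq_lim t.
Proof.
move=> ht; have th0 : 0 <= t - h by rewrite subr_ge0.
have t0 := le_trans (ltW h_gt0) ht; rewrite /est_sq_lim /mean /var addr0.
have h1 : t < t + h by rewrite ltrDl.
have h2 : t - h < t by rewrite ltrBlDr ltrDl.
by rewrite addr_gt0// divr_gt0 ?exprn_gt0 ?var_lim_gt0 ?mean_lim_gt0.
Qed.

Definition ratio_lim (t : R) : R := Num.sqrt (true_sq t) / Num.sqrt (est_sq_lim t * h).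

Lemma DeltaE t : h <= t ->
  s_true h c mu1 mu2 sigma1 sigma2 1 t / s_tilde h c mu1 mu2 sigma1 sigma2 1 t =
  ratio_lim t.
Proof. by move=> ht; rewrite s_trueE// s_tildeE// !mul1r. Qed.

Lemma true_sq_continuous : continuous true_sq.
Proof.
have sc (g : R -> R) a t : continuous g -> g (s + a) @[s --> t] --> g (t + a).
  move=> cg; apply: (@continuous_comp _ _ _ (fun s => s + a) g); last exact: cg.
  by apply: cvgD; [exact: cvg_id|exact: cvg_cst].
move=> t; apply: cvgD; apply: cvgM; try exact: cvg_cst.
  by apply: cvgB; apply: sc; exact: time1_continuous.
by apply: cvgB; apply: sc; exact: time2_continuous.
Qed.

Lemma est_sq_lim_continuous t : h <= t -> {for t, continuous est_sq_lim}.
Proof.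
move=> ht; have th0 : 0 <= t - h by rewrite subr_ge0.
have t0 : 0 <= t + 0 by rewrite addr0 (le_trans (ltW h_gt0)).
have hN : - h < 0 by rewrite oppr_lt0.
have cube (u v : R -> R) : u s @[s --> t] --> u t -> v s @[s --> t] --> v t -> v t != 0 ->
   u s / v s ^+ 3 @[s --> t] --> u t / v t ^+ 3.
  move=> hu hv v0; apply: cvgM => //; apply: cvgV; first by rewrite expf_neq0.
  by apply: (@continuous_comp _ _ _ v (fun x => x ^+ 3)) => //; exact: exprn_continuous.
apply: cvgD.
  apply: (cube (fun s => var (s + 0) (s + h)) (fun s => mean (s + 0) (s + h))).
  - exact: var_lim_continuous.
  - exact: mean_lim_continuous.
  - by rewrite gt_eqF// mean_lim_gt0// ltrD2l.
apply: (cube (fun s => var (s - h) (s + 0)) (fun s => mean (s - h) (s + 0))).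
- exact: var_lim_continuous.
- exact: mean_lim_continuous.
- by rewrite gt_eqF// mean_lim_gt0// ltrD2l.
Qed.

Lemma ratio_lim_continuous t : h <= t -> {for t, continuous ratio_lim}.
Proof.
move=> ht; apply: cvgM.
  apply: (@continuous_comp _ _ _ true_sq Num.sqrt); first exact: true_sq_continuous.
  exact: sqrt_continuous.
apply: cvgV; first by rewrite gt_eqF// sqrtr_gt0 mulr_gt0// est_sq_lim_gt0.
apply: (@continuous_comp _ _ _ (fun t => est_sq_lim t * h) Num.sqrt); last exact: sqrt_continuous.
by apply: cvgM; [exact: est_sq_lim_continuous|exact: cvg_cst].
Qed.

Lemma Delta_cadlag : cadlag h (T - h) (fun t =>
  s_true h c mu1 mu2 sigma1 sigma2 1 t / s_tilde h c mu1 mu2 sigma1 sigma2 1 t).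
Proof.
apply: (cadlag_eq_continuous (g := ratio_lim)) => t; rewrite in_itv/= => /andP[ht _].
  exact: DeltaE.
exact: ratio_lim_continuous.
Qed.

Variables (x1 x2 : nat -> R).
Hypotheses (x1_gt0 : forall j, 0 < x1 j) (x2_gt0 : forall j, 0 < x2 j).
Hypotheses (x1_mean : (\sum_(i < n) x1 i) / n%:R @[n --> \oo] --> mu1)
  (x1_sq : (\sum_(i < n) x1 i ^+ 2) / n%:R @[n --> \oo] --> mu1 ^+ 2 + sigma1 ^+ 2)
  (x2_mean : (\sum_(i < n) x2 i) / n%:R @[n --> \oo] --> mu2)
  (x2_sq : (\sum_(i < n) x2 i ^+ 2) / n%:R @[n --> \oo] --> mu2 ^+ 2 + sigma2 ^+ 2).

Let S1 n := \sum_(i < n) x1 i.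
Let S2 n := \sum_(i < n) x2 i.

Let HS1 : event_seq S1. Proof. exact: partial_sums_event_seq x1_mean. Qed.
Let HS2 : event_seq S2. Proof. exact: partial_sums_event_seq x2_mean. Qed.

Let cumsqE (x : nat -> R) n : cumsq (fun n => \sum_(i < n) x i) n = \sum_(i < n) x i ^+ 2.
Proof. by apply: eq_bigr => i _; rewrite big_ord_recr /= [X in X ^+ 2]addrC addKr. Qed.

Let S1_sq : cumsq S1 n / n%:R @[n --> \oo] --> mu1 ^+ 2 + sigma1 ^+ 2.
Proof. by under eq_fun do rewrite /S1 cumsqE. Qed.

Let S2_sq : cumsq S2 n / n%:R @[n --> \oo] --> mu2 ^+ 2 + sigma2 ^+ 2.
Proof. by under eq_fun do rewrite /S2 cumsqE. Qed.

Let F n := cseq S1 S2 c n.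
Let K n u := crank S1 S2 c n u.

Let HF n : event_seq (F n). Proof. exact: cseq_event_seq. Qed.

Let T_gt0 : 0 < T. Proof. exact: lt_trans c_gt0 c_lt. Qed.

Lemma compound_eventsE n : compound_events T c x1 x2 n = events_upto (F n) (n%:R * T).
Proof.
rewrite events_upto_splice//; first by rewrite mulr_ge0// ltW.
by rewrite ler_wpM2l// ltW.
Qed.

Definition est_sq (n : nat) (t : R) : R :=
  idx_var (F n) (K n (t + 0)) (K n (t + h)) / idx_mean (F n) (K n (t + 0)) (K n (t + h)) ^+ 3 +
  idx_var (F n) (K n (t - h)) (K n (t + 0)) / idx_mean (F n) (K n (t - h)) (K n (t + 0)) ^+ 3.

Lemma s_hatE n t : t \in `[h, T - h] ->
  s_hat h (compound_events T c x1 x2 n) n t = Num.sqrt (est_sq n t * (n%:R * h)).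
Proof.
rewrite in_itv/= => /andP[ht tT]; have t0 := le_trans (ltW h_gt0) ht.
rewrite compound_eventsE /s_hat /est_sq addr0.
have b1 : 0 <= n%:R * t by rewrite mulr_ge0.
have b2 : n%:R * t <= n%:R * (t + h) by rewrite ler_wpM2l// lerDl ltW.
have b3 : n%:R * (t + h) <= n%:R * T by rewrite ler_wpM2l// -lerBrDr.
have b4 : 0 <= n%:R * (t - h) by rewrite mulr_ge0// subr_ge0.
have b5 : n%:R * (t - h) <= n%:R * t by rewrite ler_wpM2l// gerBl ltW.
by rewrite !mu_hat_upto ?sigma2_hat_upto// (le_trans b2).
Qed.

Let ratio n t :=
  s_true h c mu1 mu2 sigma1 sigma2 n t / s_hat h (compound_events T c x1 x2 n) n t.

(** For n > 0 the common factor sqrt n cancels, and only the estimator still depends on n. *)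
Lemma ratioE n t : (0 < n)%N -> t \in `[h, T - h] ->
  ratio n t = Num.sqrt (true_sq t) / Num.sqrt (est_sq n t * h).
Proof.
move=> n0 tab; have := tab; rewrite in_itv/= => /andP[ht _].
have nr0 : 0 < n%:R :> R by rewrite ltr0n.
rewrite /ratio s_trueE// s_hatE// [est_sq n t * _]mulrCA.
rewrite sqrtrM ?(ltW nr0)// [X in _ / X](sqrtrM _ (ltW nr0)).
by rewrite invfM mulrACA divff ?mul1r// gt_eqF// sqrtr_gt0.
Qed.

(** [est_sq n] depends on t only through three event counts, which are step functions of t, while
    the numerator is continuous. *)
Lemma ratio_cadlag n : (0 < n)%N -> cadlag h (T - h) (ratio n).
Proof.
move=> n0; apply: (cadlag_mul_step (g := fun t => Num.sqrt (true_sq t))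
   (r := fun t => (Num.sqrt (est_sq n t * h))^-1)).
- by move=> t tab; rewrite ratioE.
- move=> t; apply: (@continuous_comp _ _ _ true_sq Num.sqrt); first exact: true_sq_continuous.
  exact: sqrt_continuous.
- move=> t; have r x := rank_scaled_right x t (HF n) n0.
  near=> s; rewrite /est_sq /K /crank -/(F n).
  have -> : rank (F n) (n%:R * (s + 0)) = rank (F n) (n%:R * (t + 0)) by near: s; exact: r.
  have -> : rank (F n) (n%:R * (s + h)) = rank (F n) (n%:R * (t + h)) by near: s; exact: r.
  by have -> : rank (F n) (n%:R * (s - h)) = rank (F n) (n%:R * (t - h)) by near: s; exact: r.
- move=> t; have l x := rank_scaled_left x t (HF n) n0.
  have [i1 l1] := l 0; have [i2 l2] := l h; have [i3 l3] := l (- h).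
  exists (Num.sqrt ((idx_var (F n) i1 i2 / idx_mean (F n) i1 i2 ^+ 3 +
    idx_var (F n) i3 i1 / idx_mean (F n) i3 i1 ^+ 3) * h))^-1.
  near=> s; rewrite /est_sq /K /crank -/(F n).
  have -> : rank (F n) (n%:R * (s + 0)) = i1 by near: s.
  have -> : rank (F n) (n%:R * (s + h)) = i2 by near: s.
  by have -> : rank (F n) (n%:R * (s - h)) = i3 by near: s.
Unshelve. all: by end_near. Qed.

Let ndK n u v : u <= v -> (K n u <= K n v)%N.
Proof. by move=> uv; apply: leq_rank; [exact: HF|rewrite ler_wpM2l]. Qed.

Let est_window a b t : 0 <= t + a -> a < b ->
  idx_var (F p.2) (K p.2 (p.1 + a)) (K p.2 (p.1 + b)) /
  idx_mean (F p.2) (K p.2 (p.1 + a)) (K p.2 (p.1 + b)) ^+ 3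
  @[p --> filter_prod (nbhs t) \oo] -->
  var (t + a) (t + b) / mean (t + a) (t + b) ^+ 3.
Proof.
move=> ta ab; have uv : t + a < t + b by rewrite ltrD2l.
have kuv := rank_lim_lt c_gt0 mu1_gt0 mu2_gt0 ta uv.
have Kk u : (K n u)%:R / n%:R @[n --> \oo] --> rank_lim c mu1 mu2 u by exact: crank_cvg.
have Ff u : F n (K n u) / n%:R @[n --> \oo] --> Num.max 0 u.
  exact: (cseq_crank_cvg HS1 HS2 mu1_gt0 mu2_gt0 c_gt0 x1_mean S1_sq x2_mean S2_sq).
have FSf u : F n (K n u).+1 / n%:R @[n --> \oo] --> Num.max 0 u.
  exact: (cseqS_crank_cvg HS1 HS2 mu1_gt0 mu2_gt0 c_gt0 x1_mean S1_sq x2_mean S2_sq).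
have Qq u : cumsq (F n) (K n u) / n%:R @[n --> \oo] --> cumsq_lim c mu1 mu2 sigma1 sigma2 u.
  exact: (cumsq_crank_cvg HS1 HS2 mu1_gt0 mu2_gt0 c_gt0 x1_mean S1_sq x2_mean S2_sq).
have QSq u : cumsq (F n) (K n u).+1 / n%:R @[n --> \oo] -->
    cumsq_lim c mu1 mu2 sigma1 sigma2 u.
  exact: (cumsqS_crank_cvg HS1 HS2 mu1_gt0 mu2_gt0 c_gt0 x1_mean S1_sq x2_mean S2_sq).
have ck := @rank_lim_continuous R c mu1 mu2.
have cq := @cumsq_lim_continuous R c mu1 mu2 sigma1 sigma2.
have cf := @max0_continuous R.
have hm := idx_mean_cvg HF ndK Kk Ff FSf ck cf kuv.
have hv := idx_var_cvg HF ndK Kk Ff FSf Qq QSq ck cf cq kuv.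
apply: cvgM; first exact: hv.
apply: cvgV; first by rewrite expf_neq0// gt_eqF// mean_lim_gt0.
exact: (cvg_comp _ _ hm (@exprn_continuous _ 3 _)).
Qed.

Lemma ratio_cvg_supnorm : cvg_supnorm h (T - h) ratio (fun t =>
  s_true h c mu1 mu2 sigma1 sigma2 1 t / s_tilde h c mu1 mu2 sigma1 sigma2 1 t).
Proof.
have lim : cvg_supnorm h (T - h)
   (fun n t => Num.sqrt (true_sq t) / Num.sqrt (est_sq n t * h)) ratio_lim.
  apply: cvg_supnorm_joint => [|t|t]; rewrite ?in_itv/=; first by have := h_le; lra.
    move=> /andP[ht _].
    have e : est_sq p.2 p.1 @[p --> filter_prod (nbhs t) \oo] --> est_sq_lim t.
      apply: cvgD; apply: est_window; rewrite ?addr0 ?subr_ge0 ?oppr_lt0//.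
      exact: le_trans (ltW h_gt0) ht.
    have h1 : p.1 @[p --> filter_prod (nbhs t) (\oo : set_system nat)] --> t by exact: cvg_fst.
    apply: cvgM.
      have h2 := cvg_comp _ _ h1 (@true_sq_continuous t).
      exact: (cvg_comp _ _ h2 (@sqrt_continuous _ _)).
    apply: cvgV; first by rewrite gt_eqF// sqrtr_gt0 mulr_gt0// est_sq_lim_gt0.
    have h3 : est_sq p.2 p.1 * h @[p --> filter_prod (nbhs t) \oo] --> est_sq_lim t * h.
      by apply: cvgM => //; exact: cvg_cst.
    exact: (cvg_comp _ _ h3 (@sqrt_continuous _ _)).
  by move=> /andP[ht _]; exact: ratio_lim_continuous.
apply: cvg_trans lim; apply: near_eq_cvg; exists 1%N => // n /= n0.
congr ereal_sup; apply/seteqP; split => _ [t /= tab <-]; exists t => //;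
  have := tab; rewrite in_itv/= => /andP[ht _]; by rewrite ratioE// DeltaE.
Qed.
End compound_paths.

Theorem lemma3p2 (R : realType) (d : measure_display) (Omega : measurableType d)
    (P : probability Omega R) (xi1 xi2 : nat -> {RV P >-> R})
    (T h c mu1 mu2 sigma1 sigma2 : R)
    (T_gt0 : 0 < T) (h_gt0 : 0 < h) (h_le : h <= T / 2)
    (c_gt0 : 0 < c) (c_lt : c < T)
    (mu1_gt0 : 0 < mu1) (mu2_gt0 : 0 < mu2)
    (sigma1_gt0 : 0 < sigma1) (sigma2_gt0 : 0 < sigma2)
    (Phi1 : renewal_process xi1 mu1 (sigma1 ^+ 2))
    (Phi2 : renewal_process xi2 mu2 (sigma2 ^+ 2))
    (Phi_indep : independent_processes xi1 xi2) :
  let Phi (n : nat) (w : Omega) : set R :=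
    compound_events T c (fun j => xi1 j w) (fun j => xi2 j w) n in
  let ratio (n : nat) (w : Omega) (t : R) : R :=
    s_true h c mu1 mu2 sigma1 sigma2 n t / s_hat h (Phi n w) n t in
  let Delta (t : R) : R :=
    s_true h c mu1 mu2 sigma1 sigma2 1 t / s_tilde h c mu1 mu2 sigma1 sigma2 1 t in
  cadlag h (T - h) Delta /\
  {ae P, forall w : Omega,
     (forall n : nat, (1 <= n)%N -> cadlag h (T - h) (ratio n w)) /\
     cvg_supnorm h (T - h) (fun n => ratio n w) Delta}.
Proof.
move=> Phi ratio Delta; split; first exact: Delta_cadlag.
apply: filterS2 (renewal_strong_laws Phi1) (renewal_strong_laws Phi2).
move=> w [mean1 sq1] [mean2 sq2].
have pos1 j : 0 < xi1 j w by exact: renewal_gt0 Phi1 j w.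
have pos2 j : 0 < xi2 j w by exact: renewal_gt0 Phi2 j w.
split; last exact: ratio_cvg_supnorm.
by move=> n n1; exact: ratio_cadlag mean1 mean2 n n1.
Qed.
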